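(* Let $d\geq1$ and let $x,y\in\{0,1,\dots,d\}^{\mathbb{Z}^d}$ be an asymptotic pair such that $x$ is uniformly recurrent and which satisfies the flip condition with difference set $F=\{0,-e_1,\dots,-e_d\}$. The following are equivalent: (i) For every nonempty finite connected subset $S\subset\mathbb{Z}^d$ and every $p\in\mathcal{L}_S(x)\cup\mathcal{L}_S(y)$, we have $$\#\left(\mathrm{occ}_p(x)\setminus\mathrm{occ}_p(y)\right)=1=\#\left(\mathrm{occ}_p(y)\setminus\mathrm{occ}_p(x)\right).$$ (ii) The asymptotic pair $(x,y)$ is indistinguishable. (iii) For every nonempty finite connected subset $S\subset\mathbb{Z}^d$, $\#\mathcal{L}_S(x)=\#\mathcal{L}_S(y)=\#(F-S)$. (iv) There exists a totally irrational vector $\alpha\in[0,1)^d$ such that $x=c_\alpha$ and $y=c'_\alpha$.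
   Context: Let $e_1,\dots,e_d$ be the canonical basis of $\mathbb{Z}^d$. For a finite alphabet $\Sigma$, elements of $\Sigma^{\mathbb{Z}^d}$ are configurations; the shift is $\sigma^u(x)_v=x_{u+v}$. A pattern is a map $p\colon S\to\Sigma$ with $S\subset\mathbb{Z}^d$ finite. $\mathrm{occ}_p(x)=\{n\in\mathbb{Z}^d:\sigma^n(x)|_S=p\}$ and $\mathcal{L}_S(x)=\{p\in\Sigma^S:\mathrm{occ}_p(x)\neq\varnothing\}$. A finite set $S\subset\mathbb{Z}^d$ is connected if it induces a connected subgraph of the graph on $\mathbb{Z}^d$ with edges $\{u,u+e_i\}$, $u\in\mathbb{Z}^d$, $1\le i\le d$. $F-S=\{f-s: f\in F,s\in S\}$. A configuration $x$ is uniformly recurrent if for every pattern $p$ with $\mathrm{occ}_p(x)\ne\varnothing$ there is a finite $K\subset\mathbb{Z}^d$ such that for every $u\in\mathbb{Z}^d$ there is $k\in K$ with $u+k\in\mathrm{occ}_p(x)$. Configurations $x,y$ are asymptotic if the difference set $\{u: x_u\neq y_u\}$ is finite. An asymptotic pair $(x,y)$ is indistinguishable if $\#(\mathrm{occ}_p(x)\setminus\mathrm{occ}_p(y))=\#(\mathrm{occ}_p(y)\setminus\mathrm{occ}_p(x))$ for every pattern $p$ of finite support. Flip condition for an asymptotic pair $x,y\in\{0,\dots,d\}^{\mathbb{Z}^d}$: (1) the difference set is $F=\{0,-e_1,\dots,-e_d\}$; (2) $x|_F$ is a bijection $F\to\{0,\dots,d\}$; (3) the map $x_n\mapsto y_n$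 ($n\in F$) is a cyclic permutation (a single cycle of length $d+1$) of $\{0,\dots,d\}$; with the standing normalization that $x_0=0$ and $y_n=x_n-1 \bmod (d+1)$ for every $n\in F$. A vector $\alpha=(\alpha_1,\dots,\alpha_d)$ is totally irrational if $1,\alpha_1,\dots,\alpha_d$ are linearly independent over $\mathbb{Q}$. For such $\alpha\in[0,1)^d$, $c_\alpha,c'_\alpha\colon\mathbb{Z}^d\to\{0,\dots,d\}$ are $$c_\alpha(n)=\sum_{i=1}^d\left(\lfloor\alpha_i+n\cdot\alpha\rfloor-\lfloor n\cdot\alpha\rfloor\right),\qquad c'_\alpha(n)=\sum_{i=1}^d\left(\lceil\alpha_i+n\cdot\alpha\rceil-\lceil n\cdot\alpha\rceil\right).$$ *)

(* Defs.v *)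
From HB Require Import structures.
From mathcomp Require Import all_boot all_order all_algebra all_fingroup.
From mathcomp Require Import finmap.
From mathcomp Require Import boolp classical_sets functions cardinality reals.

Set Implicit Arguments.
Unset Strict Implicit.
Unset Printing Implicit Defensive.

Import Order.TTheory GRing.Theory Num.Theory.

Local Open Scope classical_set_scope.
Local Open Scope card_scope.
Local Open Scope ring_scope.

Notation lattice d := 'rV[int]_d.

Definition basis_vec (d : nat) (i : 'I_d) : lattice d := delta_mx 0 i.

Definition lattice_adj (d : nat) : rel (lattice d) :=
  fun u v => [exists i, (v == u + basis_vec i) || (u == v + basis_vec i)].

(* The empty set is connected for this definition; nonemptiness is required
   separately where it is needed. *)
Definition connected_fset (d : nat) (S : {fset lattice d}) : Prop :=
  forall u v : S, connect (fun a b : S => lattice_adj (val a) (val b)) u v.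

Definition minkowski_sub (d : nat) (F S : {fset lattice d}) : {fset lattice d} :=
  [fset (f - s)%R | f in F, s in S]%fset.

Definition configuration (d : nat) (A : Type) : Type := lattice d -> A.

Definition shift (d : nat) (A : Type) (u : lattice d)
    (x : configuration d A) : configuration d A := fun v => x (u + v).

Definition occ (d : nat) (A : Type) (S : {fset lattice d})
    (p : {ffun S -> A}) (x : configuration d A) : set (lattice d) :=
  [set n | forall s : S, shift n x (val s) = p s].

Definition lang (d : nat) (A : Type) (S : {fset lattice d})
    (x : configuration d A) : set {ffun S -> A} :=
  [set p | occ p x !=set0].
Arguments lang {d A} S x.

Definition uniformly_recurrent (d : nat) (A : Type)
    (x : configuration d A) : Prop :=
  forall (S : {fset lattice d}) (p : {ffun S -> A}), occ p x !=set0 ->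
  exists K : {fset lattice d}, forall u : lattice d,
  exists2 k, k \in K & occ p x (u + k).

Definition diff_set (d : nat) (A : Type) (x y : configuration d A) :
  set (lattice d) := [set u | x u <> y u].

Definition asymptotic (d : nat) (A : Type) (x y : configuration d A) :
  Prop := finite_set (diff_set x y).

Definition indistinguishable (d : nat) (A : Type)
    (x y : configuration d A) : Prop :=
  asymptotic x y /\
  forall (S : {fset lattice d}) (p : {ffun S -> A}),
    (occ p x `\` occ p y) #= (occ p y `\` occ p x).

Definition flip_set (d : nat) : {fset lattice d} :=
  (0%R |` [fset (- basis_vec i)%R | i in 'I_d])%fset.

(* The last two fields are the normalization of the flip condition;
   [ord_pred] is subtraction of 1 modulo d + 1 on 'I_d.+1. *)
Record flip_condition (d : nat) (x y : configuration d 'I_d.+1) : Prop := {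
  flip_diff : diff_set x y = [set` flip_set d];
  flip_bij : set_bij [set` flip_set d] [set: 'I_d.+1] x;
  flip_cycle : exists c : 'S_d.+1,
    (forall n : lattice d, n \in flip_set d -> c (x n) = y n) /\
    #|porbit c ord0| = d.+1;
  flip_origin : x 0 = ord0;
  flip_pred : forall n : lattice d, n \in flip_set d -> y n = ord_pred (x n)
}.

Definition totally_irrational (R : realType) (d : nat) (alpha : 'rV[R]_d) :
  Prop :=
  forall (q0 : rat) (q : 'I_d -> rat),
    ratr q0 * 1 + \sum_(i < d) ratr (q i) * alpha 0 i = 0 :> R ->
    q0 = 0 /\ forall i, q i = 0.

Definition dotZ (R : realType) (d : nat) (n : lattice d) (alpha : 'rV[R]_d) :
  R := \sum_(i < d) (n 0 i)%:~R * alpha 0 i.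

Definition c_floor (R : realType) (d : nat) (alpha : 'rV[R]_d)
    (n : lattice d) : int :=
  \sum_(i < d) (Num.floor (alpha 0 i + dotZ n alpha)
                - Num.floor (dotZ n alpha)).

Definition c_ceil (R : realType) (d : nat) (alpha : 'rV[R]_d)
    (n : lattice d) : int :=
  \sum_(i < d) (Num.ceil (alpha 0 i + dotZ n alpha)
                - Num.ceil (dotZ n alpha)).

(* Main.v *)
(* Write F for the flip set. A pattern on S occurring in exactly one of x, y at
   u forces u to lie in the window F - S, so indistinguishability says that x
   and y show every pattern equally often over each window ("balanced").

   (ii) => (i): enlarge S by an adjacent vertex v. The window gains the points
   f - v for some f in F, never for all of them. The letters seen there at v
   are those of x and y on F, which differ by one step along the cycle of
   length d + 1, so balance turns the set of letters added to a given pattern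
   of S into a proper arc of that cycle. By induction on S, every pattern occurs
   in the window, exactly once, and the map matching the y-pattern at one point
   of the window with the equal x-pattern at another is a single cycle.

   (ii) => (iv): coding letters by the ranks x(-e_i) gives a {0,1}-valued
   1-form on Z^d. Functions of patterns that agree for x and y over the window
   are constant because of the single cycle; this makes the form closed, and its
   potential H satisfies 0 <= H(u + v) - H(u) - H(v) <= 1. Hence H is the floor
   of a linear form n.alpha up to integral values, which uniform recurrence
   excludes away from 0.

   (iii) => (ii): the complexity hypothesis makes the space of relations between
   the patterns on v |` S exactly as small as the new points of the window
   allow, which forces balance to propagate from S to v |` S.

   (iv) => (ii): ordering the window by n.alpha modulo 1, the x-pattern at each
   point is the y-pattern at the next one. *)
Require Import Defs.
From HB Require Import structures.
From mathcomp Require Import all_boot all_order all_algebra all_fingroup.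
From mathcomp Require Import finmap.
From mathcomp Require Import boolp classical_sets functions cardinality reals.
From mathcomp Require Import zify ring lra.

Set Implicit Arguments.
Unset Strict Implicit.
Unset Printing Implicit Defensive.

Import Order.TTheory GRing.Theory Num.Theory.

Local Open Scope classical_set_scope.
Local Open Scope card_scope.
Local Open Scope ring_scope.

(** * Preliminaries *)

Lemma lattice_ind (d : nat) (P : lattice d -> Prop) :
  P 0 -> (forall v i, P v -> P (v + basis_vec i)) ->
  (forall v i, P v -> P (v - basis_vec i)) -> forall v, P v.
Proof.
move=> P0 Pp Pm.
have Pz i (z : int) u : P u -> P (u + z *: basis_vec i).
  move=> Pu; elim/int_ind: z => [|n IH|n IH]; first by rewrite scale0r addr0.
    by rewrite intS scalerDl scale1r addrCA addrC; apply: Pp.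
  by rewrite intS opprD scalerDl scaleN1r addrCA addrC; apply: Pm.
move=> v; rewrite (row_sum_delta v).
elim: (index_enum _) => [|i r IH]; first by rewrite big_nil.
by rewrite big_cons addrC; apply: Pz.
Qed.

(** Repeated predecessors descend from [j0] to 0, wrap round to [n], and descend again to any
    [j]. *)
Lemma ord_pred_ind (n : nat) (P : 'I_n.+1 -> Prop) (j0 : 'I_n.+1) :
  (forall j, P j -> P (ord_pred j)) -> P j0 -> forall j, P j.
Proof.
move=> Pp Pj0.
have down (m k : nat) (lt_mk : (m + k < n.+1)%N) (lt_m : (m < n.+1)%N) :
    P (Ordinal lt_mk) -> P (Ordinal lt_m).
  elim: k lt_mk => [|k IH] lt_mk.
    by congr P; apply: val_inj; rewrite /= addn0.
  move=> /Pp Pk; apply: (IH _); first by rewrite -ltnS -addnS ltnW.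
  move=> lt_mk'; move: Pk; congr P; apply: val_inj => /=.
  by rewrite (_ : _.-1 = m + k + n.+1)%N ?modnDr ?modn_small //; lia.
have P0 : P ord0.
  have h : (0 + j0 < n.+1)%N by rewrite add0n.
  have := @down 0%N j0 h (ltn0Sn n); rewrite (_ : Ordinal h = j0); last exact: val_inj.
  by move=> /(_ Pj0); congr P; apply: val_inj.
move=> j.
have h : (j + (n - j) < n.+1)%N by rewrite subnKC // -ltnS.
have := @down j (n - j)%N h (ltn_ord j).
rewrite (_ : Ordinal (ltn_ord j) = j); last exact: val_inj.
apply; move: (Pp _ P0); congr P; apply: val_inj => /=.
by rewrite modn_small // subnKC // -ltnS.
Qed.

Lemma linear_dependency (F : fieldType) (I J : finType) (C : I -> J -> F) :
  (#|J| < #|I|)%N ->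
  exists2 c : I -> F, exists i, c i != 0 & forall j, \sum_i c i * C i j = 0.
Proof.
move=> ltJI.
pose M := \matrix_(i < #|I|, j < #|J|) C (enum_val i) (enum_val j).
have : kermx M != 0.
  rewrite kermx_eq0 -row_leq_rank -ltnNge.
  by apply: leq_ltn_trans (rank_leq_col M) ltJI.
case/rowV0Pn=> v /sub_kermxP vM /rV0Pn[i vi].
exists (fun a => v 0 (enum_rank a)); first by exists (enum_val i); rewrite enum_valK.
move=> j; have /rowP/(_ (enum_rank j)) := vM; rewrite !mxE => vMj.
apply: etrans vMj.
rewrite (reindex (@enum_val I I)) /=; last first.
  by exists enum_rank => k _; rewrite ?enum_valK ?enum_rankK.
by apply: eq_bigr => k _; rewrite mxE enum_valK enum_rankK.
Qed.

Lemma int_antidifference (g : int -> int) :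
  exists s : int -> int, forall t, s (t + 1) - s t = g t :> int.
Proof.
exists (fun t => match t with
  | Posz n => \sum_(k < n) g k%:Z
  | Negz n => - \sum_(k < n.+1) g (Negz k) end).
case=> n; first by rewrite -PoszD addn1 big_ord_recr /= addrAC subrr add0r.
case: n => [|n].
  by rewrite /= big_ord0 big_ord_recr big_ord0 /= !add0r opprK.
have -> : Negz n.+1 + 1 = Negz n by lia.
by rewrite opprK addrC big_ord_recr /= addrAC subrr add0r.
Qed.

(* Coordinates are integrated one at a time. *)
Lemma lattice_potential (d : nat) (f : 'I_d -> lattice d -> int) :
  (forall i j n, f i n + f j (n + basis_vec i) =
                 f j n + f i (n + basis_vec j) :> int) ->
  exists H : lattice d -> int,
    forall i n, H (n + basis_vec i) - H n = f i n :> int.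
Proof.
move=> closed.
suff [H HH] : exists H : lattice d -> int,
    forall i (n : lattice d), i \in enum 'I_d -> H (n + basis_vec i) - H n = f i n :> int.
  by exists H => i n; apply: HH; rewrite mem_enum.
elim: (enum _) => [|i0 r [H HH]]; first by exists (fun=> 0).
case: (boolP (i0 \in r)) => [i0r|i0r].
  by exists H => i n; rewrite inE => /orP[/eqP->|]; apply: HH.
(* The defect left in direction [i0]. Closedness makes it invariant under the directions already
   treated, so integrating it along [i0] does not disturb them. *)
pose g (n : lattice d) : int := f i0 n - (H (n + basis_vec i0) - H n).
have g_inv i (n : lattice d) : i \in r -> g (n + basis_vec i) = g n.
  move=> ir; rewrite /g; have := closed i i0 n.
  have := HH i n ir; have := HH i (n + basis_vec i0) ir.
  have -> : n + basis_vec i + basis_vec i0 = n + basis_vec i0 + basis_vec i.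
    by rewrite addrAC.
  by move=> *; lia.
pose line (n : lattice d) (t : int) : lattice d := n + (t - n 0 i0) *: basis_vec i0.
have [s sP] := boolp.choice int_antidifference.
pose G (n : lattice d) : int := s (g \o line n) (n 0 i0).
exists (fun n => H n + G n) => i n; rewrite inE => /orP[/eqP->|ir].
  have -> : G (n + basis_vec i0) = s (g \o line n) (n 0 i0 + 1).
    rewrite /G !mxE !eqxx /=; congr s; apply/funext => t /=; congr g.
    rewrite /line !mxE !eqxx /= opprD addrA scalerBl scale1r addrACA.
    by rewrite subrr addr0.
  have := sP (g \o line n) (n 0 i0).
  have -> : (g \o line n) (n 0 i0) = g n by rewrite /= /line subrr scale0r addr0.
  rewrite /g /G.
  by move: (s _ _) (s _ _) => *; lia.
have nei : i0 == i = false.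
  by apply/eqP => ei; rewrite ei ir in i0r.
have -> : G (n + basis_vec i) = G n.
  rewrite /G !mxE eqxx nei /= addr0; congr s; apply/funext => t /=.
  rewrite /line !mxE eqxx nei /= addr0 (addrAC n); exact: g_inv.
by rewrite opprD addrACA subrr addr0 HH.
Qed.

(** * Connected sets and windows *)

Lemma lattice_adj_sym (d : nat) : symmetric (@lattice_adj d).
Proof. by move=> u v; apply: eq_existsb => i; rewrite orbC. Qed.

Lemma adj_basis (d : nat) (v : lattice d) i : lattice_adj v (v + basis_vec i).
Proof. by apply/existsP; exists i; rewrite eqxx. Qed.

(** The nonempty connected sets, presented so as to allow induction by adding one neighbour at a
    time. *)
Inductive grown (d : nat) : {fset lattice d} -> Prop :=
| grown_seed s : grown [fset s]%fset
| grown_add S s v : grown S -> s \in S -> lattice_adj s v ->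
    grown (v |` S)%fset.

Lemma growth_reaches (d : nat) (P : {fset lattice d} -> Prop) S
    (s : lattice d) :
  (forall T (t v : lattice d), P T -> t \in T -> lattice_adj t v -> P (v |` T)%fset) ->
  P S -> s \in S -> forall w : lattice d, exists T, [/\ P T, s \in T & w \in T].
Proof.
move=> Padd PS sS w.
pose Q (u : lattice d) := exists T, [/\ P T, s \in T & s + u \in T].
suff: Q (w - s) by rewrite /Q addrCA subrr addr0.
elim/lattice_ind: (w - s) => [|v i|v i]; first by exists S; rewrite addr0.
- case=> T [PT sT vT]; exists ((s + (v + basis_vec i))%R |` T)%fset.
  rewrite !inE eqxx sT orbT; split=> //.
  by apply: Padd PT vT _; rewrite addrA adj_basis.
case=> T [PT sT vT]; exists ((s + (v - basis_vec i))%R |` T)%fset.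
rewrite !inE eqxx sT orbT; split=> //; apply: Padd PT vT _.
have := adj_basis (s + (v - basis_vec i)) i.
by rewrite lattice_adj_sym -addrA subrK.
Qed.

Lemma grown_nonempty (d : nat) (S : {fset lattice d}) :
  grown S -> S != fset0.
Proof.
by case=> [s|T s v _ _ _]; apply/fset0Pn; [exists s|exists v]; rewrite !inE eqxx.
Qed.

Lemma connected_fsetP (d : nat) (S : {fset lattice d}) :
  connected_fset S <->
  forall (B : pred (lattice d)) u, u \in S -> B u ->
    (forall s t, s \in S -> t \in S -> lattice_adj s t -> B s -> B t) ->
    forall t, t \in S -> B t.
Proof.
split=> [conn B u uS Bu stepB t tS|conn u v].
  have /connectP[p] := conn [` uS]%fset [` tS]%fset.
  have : B (val [` uS]%fset) by [].
  elim: p [` uS]%fset => [|w p IH] a Ba /=.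
    by move=> _ /(congr1 val) /= ->.
  case/andP=> aw pw; apply: IH => //.
  exact: stepB (valP a) (valP w) aw Ba.
set e := fun a b : S => lattice_adj (val a) (val b).
pose B (w : lattice d) := if insub w is Some w' then connect e u w' else false.
have Bval (w : S) : B (val w) = connect e u w by rewrite /B valK.
rewrite -Bval; apply: (conn B (val u)) (valP v) => //; first exact: valP.
  by rewrite Bval connect0.
move=> s t sS tS adj; rewrite -[s]/(val [` sS]%fset) -[t]/(val [` tS]%fset).
by rewrite !Bval => /connect_trans; apply; apply: connect1.
Qed.

Lemma grown_connected (d : nat) (S : {fset lattice d}) :
  grown S -> connected_fset S.
Proof.
elim=> [s|T s v _ /connected_fsetP conn sT sv]; apply/connected_fsetP => B u.
  by rewrite inE => /eqP-> Bs _ t; rewrite inE => /eqP->.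
move=> uvT Bu stepB.
have stepT : forall a b, a \in T -> b \in T -> lattice_adj a b -> B a -> B b.
  by move=> a b aT bT; apply: stepB; rewrite inE (aT, bT) orbT.
have vvT : v \in (v |` T)%fset by rewrite !inE eqxx.
have svT : s \in (v |` T)%fset by rewrite !inE sT orbT.
have BT : forall t, t \in T -> B t.
  move: uvT; rewrite !inE => /orP[/eqP uv|uT]; last exact: conn uT Bu stepT.
  apply: conn sT _ stepT; apply: stepB vvT svT _ _; last by rewrite -uv.
  by rewrite lattice_adj_sym.
move=> t; rewrite !inE => /orP[/eqP->|]; last exact: BT.
exact: stepB svT vvT sv (BT s sT).
Qed.

(** A grown proper subset of [S] that contains [s0] has an edge leaving it inside [S], so it can be
    enlarged until it fills [S]. *)
Lemma connected_grown (d : nat) (S : {fset lattice d}) :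
  S != fset0 -> connected_fset S -> grown S.
Proof.
case/fset0Pn=> s0 s0S /connected_fsetP conn.
have grow n : exists T, [/\ grown T, s0 \in T, (T `<=` S)%fset &
    (T == S) || (n < #|` T|)%N].
  elim: n => [|n [T [gT s0T sub]]].
    exists [fset s0]%fset; rewrite cardfs1 orbT fsub1set s0S inE eqxx.
    by split=> //; apply: grown_seed.
  case: (T =P S) => [TS _|/eqP TS /= ltn].
    by exists T; rewrite {4}TS eqxx.
  have [[s [t [sT tS tT st]]]|noedge] := pselect
    (exists s t, [/\ s \in T, t \in S, t \notin T & lattice_adj s t]).
    exists (t |` T)%fset; split; first exact: grown_add gT sT st.
    - by rewrite !inE s0T orbT.
    - by rewrite fsubUset fsub1set tS.
    by rewrite cardfsU1 tT add1n ltnS ltn orbT.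
  case/eqP: TS; apply/eqP; rewrite eqEfsubset sub; apply/fsubsetP.
  apply: (conn (fun t => t \in T)) s0S s0T _ => s t sS tS st sT.
  by apply/negPn/negP => tT; apply: noedge; exists s, t.
have [T [gT _ sub]] := grow #|` S|.
case/orP=> [/eqP<-//|]; by rewrite ltnNge fsubset_leq_card.
Qed.

Lemma flip_setP (d : nat) (u : lattice d) :
  reflect (u = 0 \/ exists i, u = - basis_vec i) (u \in flip_set d).
Proof.
rewrite !inE; apply: (iffP orP).
  by case=> [/eqP->|/imfsetP[i _ ->]]; [left|right; exists i].
by case=> [->|[i ->]]; [left|right; apply/imfsetP; exists i].
Qed.

Lemma flip_set0 (d : nat) : (0 : lattice d) \in flip_set d.
Proof. by apply/flip_setP; left. Qed.

Lemma flip_setN (d : nat) i : - basis_vec i \in flip_set d.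
Proof. by apply/flip_setP; right; exists i. Qed.

Local Notation window S := (minkowski_sub (flip_set _) S).

Lemma windowP (d : nat) (S : {fset lattice d}) (u : lattice d) :
  reflect (exists2 s, s \in S & u + s \in flip_set d) (u \in window S).
Proof.
apply: (iffP idP) => [|[s sS usF]].
  case/imfset2P=> f /= fF [s /= sS ->].
  by exists s; rewrite ?subrK.
apply/imfset2P; exists (u + s) => //; exists s => //.
by rewrite addrK.
Qed.

Lemma window_sub (d : nat) (S T : {fset lattice d}) :
  (S `<=` T)%fset -> (window S `<=` window T)%fset.
Proof.
move=> /fsubsetP ST; apply/fsubsetP => u /windowP[s /ST sT usF].
by apply/windowP; exists s.
Qed.

(* An edge of the grid always joins two points of some translate of the flip
   set. *)
Lemma flip_translate_meets_window (d : nat) (S : {fset lattice d}) s v :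
  s \in S -> lattice_adj s v -> exists2 f, f \in flip_set d & f - v \in window S.
Proof.
move=> sS /existsP[i /orP[/eqP->|/eqP sE]].
  exists 0; first exact: flip_set0.
  apply/windowP; exists s => //.
  by rewrite sub0r opprD addrAC addNr add0r flip_setN.
exists (- basis_vec i); first exact: flip_setN.
apply/windowP; exists s; rewrite // sE addrA subrK addNr; exact: flip_set0.
Qed.

(** * Balanced supports *)

(** At [a = ord_pred j] the hypothesis reads [c (ord_pred j) = c j], and the cycle reaches every
    letter. *)
Lemma cyclic_cut (R : pzRingType) (n : nat) (c : 'I_n.+1 -> R) :
  (forall a, \sum_j c j * ((j == a)%:R - (ord_pred j == a)%:R) = 0) ->
  forall i j, c i = c j.
Proof.
move=> sum0 i; apply: (ord_pred_ind (j0 := i)) => // j ->.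
have := sum0 (ord_pred j).
under eq_bigr do rewrite mulrBr.
rewrite sumrB (bigD1 (ord_pred j)) //= eqxx mulr1 big1 ?addr0; last first.
  by move=> k /negPf ->; rewrite mulr0.
rewrite (bigD1 j) //= eqxx mulr1 big1 ?addr0; last first.
  by move=> k kj; rewrite (inj_eq (can_inj (@ord_predK _))) (negPf kj) mulr0.
by move/subr0_eq.
Qed.

Section FlipPair.

Variables (d : nat) (x y : configuration d 'I_d.+1).
Hypothesis hflip : flip_condition x y.

(** Patterns are handled as whole configurations compared on [S] only, so that no function type
    changes when [S] grows. *)
Definition agree (S : {fset lattice d}) (z w : configuration d 'I_d.+1) :=
  [forall s : S, z (val s) == w (val s)].

Definition local_on (S : {fset lattice d}) (T : Type)
    (Phi : configuration d 'I_d.+1 -> T) :=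
  forall z w, agree S z w -> Phi z = Phi w.

Lemma agreeP (S : {fset lattice d}) z w :
  reflect (forall s, s \in S -> z s = w s) (agree S z w).
Proof.
apply: (iffP forallP) => [zw s sS|zw s]; last by apply/eqP/zw/valP.
exact/eqP/(zw [` sS]%fset).
Qed.

Lemma agreexx S z : agree S z z.
Proof. by apply/agreeP. Qed.

Lemma agree_sym S z w : agree S z w = agree S w z.
Proof. by apply: eq_forallb => s; rewrite eq_sym. Qed.

Lemma agree_trans S z w t : agree S z w -> agree S w t -> agree S z t.
Proof.
by move=> /agreeP zw /agreeP wt; apply/agreeP => s sS; rewrite zw ?wt.
Qed.

Lemma agree_eql S z w t : agree S z w -> agree S z t = agree S w t.
Proof.
move=> zw; apply/idP/idP; apply: agree_trans => //.
by rewrite agree_sym.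
Qed.

Lemma agree_sub (S T : {fset lattice d}) z w :
  (S `<=` T)%fset -> agree T z w -> agree S z w.
Proof.
by move=> /fsubsetP ST /agreeP zw; apply/agreeP => s /ST /zw.
Qed.

Lemma agree_add S v z w :
  agree (v |` S)%fset z w = (z v == w v) && agree S z w.
Proof.
apply/agreeP/andP => [zw|[/eqP zwv /agreeP zw] s].
  split; first by rewrite zw // !inE eqxx.
  by apply/agreeP => s sS; rewrite zw // !inE sS orbT.
by rewrite !inE => /orP[/eqP->|/zw].
Qed.

Lemma local_agree S w : local_on S (fun z => agree S z w).
Proof. by move=> z t zt; rewrite (agree_eql _ zt). Qed.

Lemma flip_neq u : (x u != y u) = (u \in flip_set d).
Proof.
have /seteqP[sub sup] := flip_diff hflip.
by apply/idP/idP => [/eqP/sub|/sup/eqP].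
Qed.

Lemma flip_off u : u \notin flip_set d -> x u = y u.
Proof. by rewrite -flip_neq negbK => /eqP. Qed.

Lemma site_ex (j : 'I_d.+1) : exists f, (f \in flip_set d) && (x f == j).
Proof.
have [_ _ /(_ j I)[f fF <-]] := flip_bij hflip.
by exists f; rewrite eqxx andbT.
Qed.

(** Indexing the flip set by the letters of [x] turns the flip into [ord_pred] on the index. *)
Definition site (j : 'I_d.+1) : lattice d := xchoose (site_ex j).

Lemma site_flip j : site j \in flip_set d.
Proof. by case/andP: (xchooseP (site_ex j)). Qed.

Lemma x_site j : x (site j) = j.
Proof. by case/andP: (xchooseP (site_ex j)) => _ /eqP. Qed.

Lemma y_site j : y (site j) = ord_pred j.
Proof. by rewrite (flip_pred hflip (site_flip j)) x_site. Qed.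

Lemma siteK f : f \in flip_set d -> site (x f) = f.
Proof.
have [_ inj _] := flip_bij hflip.
move=> fF; apply: inj; rewrite ?x_site ?inE //=; exact: site_flip.
Qed.

Lemma site_inj : injective site.
Proof. by move=> i j /(congr1 x); rewrite !x_site. Qed.

Lemma window_agree S u :
  (u \in window S) = ~~ agree S (shift u x) (shift u y).
Proof.
apply: esym; apply/idP/idP => [|/windowP[s sS usF]].
  apply: contraR => /windowP nuS; apply/agreeP => s sS.
  by apply: flip_off; apply/negP => usF; apply: nuS; exists s.
by apply/negP => /agreeP/(_ s sS)/eqP; apply/negP; rewrite flip_neq.
Qed.

Lemma agree_off S u : u \notin window S -> agree S (shift u x) (shift u y).
Proof. by rewrite window_agree negbK. Qed.

Definition fresh S v (j : 'I_d.+1) := site j - v \notin window S.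

Lemma window_add S v : window (v |` S)%fset =
  (window S `|` [fset (site j - v)%R | j in 'I_d.+1 & fresh S v j])%fset.
Proof.
apply/fsetP => u; rewrite in_fsetU; apply/windowP/orP.
  case=> s; rewrite in_fset1U => /orP[/eqP->|sS] usF; last first.
    by left; apply/windowP; exists s.
  have [|nuS] := boolP (u \in window S); [by left|right].
  apply/imfsetP; exists (x (u + v)); rewrite /= ?siteK ?addrK //.
  by rewrite inE /fresh siteK // addrK.
case=> [/windowP[s sS usF]|/imfsetP[j _ ->]].
  by exists s; rewrite // in_fset1U sS orbT.
by exists v; rewrite ?subrK ?site_flip // fset1U1.
Qed.

Lemma big_window_add (V : nmodType) S v (F : lattice d -> V) :
  \sum_(u <- window (v |` S)%fset) F u =
  \sum_(u <- window S) F u + \sum_(j | fresh S v j) F (site j - v).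
Proof.
rewrite (big_fsetID _ (fun u => u \in window S)) /=; congr (_ + _).
  apply: eq_fbigl => u; rewrite !in_fset !inE window_add in_fsetU /=.
  by case: (u \in window S); rewrite ?andbF.
transitivity (\sum_(u <- [fset (site j - v)%R | j in 'I_d.+1 & fresh S v j]%fset) F u).
  apply: eq_fbigl => u; rewrite !in_fset !inE window_add in_fsetU /=.
  case: (boolP (u \in window S)) => uS; rewrite ?andbT ?andbF //=.
  by apply/esym/negP => /imfsetP[j jf uj]; move: jf; rewrite inE /fresh -uj uS.
rewrite big_imfset /=; last by move=> i j _ _ /addIr/site_inj.
by rewrite big_filter big_enum_cond /=.
Qed.


(** Admitting every integer function of the pattern, and not only indicators, leaves the test
    function free; by [balancedP] this amounts to equal pattern counts. *)
Definition balanced (S : {fset lattice d}) := forall Phi, local_on S Phi ->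
  \sum_(u <- window S) (Phi (shift u x) - Phi (shift u y)) = 0 :> int.

Lemma local_sub (T : Type) (S S' : {fset lattice d})
    (Phi : configuration d 'I_d.+1 -> T) :
  (S `<=` S')%fset -> local_on S Phi -> local_on S' Phi.
Proof. by move=> SS' loc z w /(agree_sub SS') /loc. Qed.

(** Window points of [T] outside the window of [S] contribute nothing, as [x] and [y] agree there on
    [S]. *)
Lemma balanced_sub (S T : {fset lattice d}) :
  (S `<=` T)%fset -> balanced T -> balanced S.
Proof.
move=> ST bal Phi loc; rewrite -(bal Phi (local_sub ST loc)).
apply: big_fset_incl => [|u _ /agree_off/loc->]; first exact: window_sub.
by rewrite subrr.
Qed.

(** The letters that new window points put at [v] next to the pattern of [w]: there [x] shows [j],
    while [y], equal to [x] on [S], shows [ord_pred j]. *)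
Definition chi S v w (j : 'I_d.+1) :=
  fresh S v j && agree S (shift (site j - v) x) w.

(** Balance is tested on [phi] of the letter at [v], restricted to the pattern of [w]. At a new
    point only the change of letter at [v] remains. *)
Lemma step_identity S v w (phi : 'I_d.+1 -> int) : balanced (v |` S)%fset ->
  \sum_(u <- window S) ((if agree S (shift u x) w then phi (x (u + v)) else 0)
     - (if agree S (shift u y) w then phi (y (u + v)) else 0))
  + \sum_j (chi S v w j)%:R * (phi j - phi (ord_pred j)) = 0 :> int.
Proof.
move=> bal.
pose Phi (z : configuration d 'I_d.+1) : int :=
  if agree S z w then phi (z v) else 0.
have loc : local_on (v |` S)%fset Phi.
  move=> z t; rewrite agree_add /Phi => /andP[/eqP -> zt].
  by rewrite (agree_eql _ zt).
rewrite -[RHS](bal Phi loc) big_window_add; congr (_ + _).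
rewrite [RHS]big_mkcond; apply: eq_bigr => j _; rewrite /chi /Phi.
case: (boolP (fresh S v j)) => fj; rewrite ?mul0r //=.
rewrite /shift subrK x_site y_site -!/(shift _ _).
rewrite (agree_eql w (agree_off fj)).
by case: agree; rewrite ?mul1r // mul0r subrr.
Qed.

Lemma fresh_missing S s v :
  s \in S -> lattice_adj s v -> exists j, ~~ fresh S v j.
Proof.
move=> sS sv; have [f fF fvS] := flip_translate_meets_window sS sv.
by exists (x f); rewrite /fresh siteK // negbK.
Qed.

(** By [cyclic_cut], [chi] is constant, and it vanishes at a letter that is not fresh. *)
Lemma chi_none S s v w : s \in S -> lattice_adj s v ->
  (forall phi : 'I_d.+1 -> int,
     \sum_j (chi S v w j)%:R * (phi j - phi (ord_pred j)) = 0) ->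
  forall j, ~~ chi S v w j.
Proof.
move=> sS sv sum0 j; have [j0 j0f] := fresh_missing sS sv.
have := cyclic_cut (fun a => sum0 (fun k => (k == a)%:R)) j j0.
by rewrite {2}/chi (negPf j0f); case: (chi S v w j).
Qed.

Lemma fresh_chi S v w j : fresh S v j ->
  agree S (shift (site j - v) x) w -> chi S v w j.
Proof. by rewrite /chi => -> ->. Qed.

Lemma window_addP S v u : u \in window (v |` S)%fset ->
  u \in window S \/ exists2 j, fresh S v j & u = site j - v.
Proof.
rewrite window_add in_fsetU => /orP[|/imfsetP[j /= jf ->]]; first by left.
by right; exists j => //; move: jf; rewrite inE.
Qed.

End FlipPair.

(** * Occurrence, separation and the single cycle *)

Section Balanced.

Variables (d : nat) (x y : configuration d 'I_d.+1).
Hypothesis hflip : flip_condition x y.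

Lemma balanced_occurs (S : {fset lattice d}) w : balanced x y S ->
  (exists2 u, u \in window S & agree S (shift u x) w) <->
  (exists2 u, u \in window S & agree S (shift u y) w).
Proof.
move=> /(_ (fun z => (agree S z w)%:R)) bal.
have {bal} : \sum_(u <- window S) (agree S (shift u x) w)%:R
    = \sum_(u <- window S) (agree S (shift u y) w)%:R :> int.
  apply/eqP; rewrite -subr_eq0 -sumrB; apply/eqP/bal => z t zt.
  by rewrite (agree_eql _ zt).
have pos z : (exists2 u, u \in window S & agree S (shift u z) w) <->
    \sum_(u <- window S) (agree S (shift u z) w)%:R != 0 :> int.
  split=> [[u uS uw]|].
    rewrite gt_eqF // (big_fsetD1 u) //= uw addrC ltr_wpDl // sumr_ge0 //.
  apply: contra_neqP => none; rewrite big_seq big1 // => u uS.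
  by case: (boolP (agree _ _ _)) => // uw; case: none; exists u.
by move=> e; rewrite !pos e.
Qed.

Hypothesis bal : forall S, balanced x y S.

(* Growing [S] towards the flip set, an absent pattern stays absent: by the
   step identity [chi] is constant along the cycle, hence zero. *)
Lemma occurs_in_window (S : {fset lattice d}) n : S != fset0 ->
  exists2 u, u \in window S & agree S (shift u x) (shift n x).
Proof.
case/fset0Pn=> s sS; apply: contrapT => absent.
pose P (T : {fset lattice d}) :=
  ~ exists2 u, u \in window T & agree T (shift u x) (shift n x).
(* Once [T] contains [-n], the point [n] itself is in the window of [T], where the pattern does
   occur. *)
have [|T [PT _ nT]] := @growth_reaches d P S s _ absent sS (- n); last first.
  apply: PT; exists n; last exact: agreexx.
  by apply/windowP; exists (- n); rewrite // subrr flip_set0.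
move=> T t v PT tT tv [u uvT].
rewrite agree_add => /andP[_ uw].
case: (window_addP hflip uvT) => [uT|[j fj uj]]; first by case: PT; exists u.
rewrite uj in uw; have := fresh_chi fj uw; apply/negP.
apply: chi_none tT tv _ _ => phi.
have := step_identity hflip (shift n x) phi (@bal (v |` T)%fset).
rewrite big_seq big1 ?add0r // => m mT.
have noy : ~ exists2 u, u \in window T & agree T (shift u y) (shift n x).
  by move/(balanced_occurs _ (@bal T)).
case: (boolP (agree _ _ _)) => mw; first by case: PT; exists m.
case: (boolP (agree _ _ _)) => mw'; first by case: noy; exists m.
by rewrite subrr.
Qed.

Lemma occurs_in_window_y (S : {fset lattice d}) n : S != fset0 ->
  exists2 u, u \in window S & agree S (shift u y) (shift n x).
Proof. by move=> S0; apply/balanced_occurs/occurs_in_window. Qed.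

Definition separated (z : configuration d 'I_d.+1) (S : {fset lattice d}) :=
  forall u v, u \in window S -> v \in window S ->
  agree S (shift u z) (shift v z) -> u = v.

Lemma separated_sum (z : configuration d 'I_d.+1) S w (G : lattice d -> int) u :
  separated z S -> u \in window S -> agree S (shift u z) w ->
  \sum_(v <- window S) (if agree S (shift v z) w then G v else 0) = G u.
Proof.
move=> sep uS uw; rewrite (big_fsetD1 u) //= uw big_seq big1 ?addr0 // => v.
rewrite !inE => /andP[vu vS]; case: ifP => // vw.
case/eqP: vu; apply: sep => //; apply: agree_trans vw _.
by rewrite agree_sym.
Qed.

Section Step.

Variables (S : {fset lattice d}) (s v : lattice d) (w : configuration d 'I_d.+1).
Variables u m : lattice d.
Hypotheses (sS : s \in S) (sv : lattice_adj s v).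
Hypotheses (sepx : separated x S) (sepy : separated y S).
Hypotheses (uS : u \in window S) (uw : agree S (shift u x) w).
Hypotheses (mS : m \in window S) (mw : agree S (shift m y) w).

(** Separation leaves one [x]-term and one [y]-term of the window sum. This is a boundary relation:
    [chi] is the arc of the cycle that starts just after [x (u + v)] and ends at [y (m + v)], empty
    if these letters coincide. *)
Lemma step_arc (phi : 'I_d.+1 -> int) :
  phi (x (u + v)) - phi (y (m + v)) +
  \sum_j (chi hflip S v w j)%:R * (phi j - phi (ord_pred j)) = 0 :> int.
Proof.
rewrite -[RHS](step_identity hflip w phi (@bal (v |` S)%fset)) sumrB.
rewrite (separated_sum (fun u => phi (x (u + v))) sepx uS uw).
by rewrite (separated_sum (fun u => phi (y (u + v))) sepy mS mw).
Qed.

Lemma step_arc_ends c :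
  (x (u + v) == c)%:R - (y (m + v) == c)%:R + (chi hflip S v w c)%:R
  - (chi hflip S v w (ordS c))%:R = 0 :> int.
Proof.
have := step_arc (fun j => (j == c)%:R).
under eq_bigr do rewrite mulrBr.
rewrite sumrB (bigD1 c) //= eqxx mulr1 big1 ?addr0; last first.
  by move=> k /negPf ->; rewrite mulr0.
rewrite (bigD1 (ordS c)) //= ordSK eqxx mulr1 big1 ?addr0; last first.
  move=> k kc; rewrite (_ : _ == _ = false) ?mulr0 //.
  by apply/negbTE; apply: contra kc => /eqP <-; rewrite ord_predK.
by rewrite addrA.
Qed.

Lemma step_empty : x (u + v) = y (m + v) -> forall j, ~~ chi hflip S v w j.
Proof.
move=> e; apply: (chi_none sS sv) => phi.
by have := step_arc phi; rewrite e subrr add0r.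
Qed.

(** Otherwise [chi] would take the value 2 just after [x (u + v)], unless the two ends coincide, and
    then [chi] is empty. *)
Lemma step_x_fresh : ~~ chi hflip S v w (x (u + v)).
Proof.
apply/negP => chia; have := step_arc_ends (x (u + v)); rewrite chia eqxx.
case: (_ =P x (u + v)) => [e|_]; last by case: chi.
by move: (step_empty (esym e) (x (u + v))); rewrite chia.
Qed.

Lemma step_y_fresh : ~~ chi hflip S v w (ordS (y (m + v))).
Proof.
apply/negP => chib; have := step_arc_ends (y (m + v)); rewrite chib eqxx.
case: (_ =P y (m + v)) => [e|_]; last by case: chi.
by move: (step_empty e (ordS (y (m + v)))); rewrite chib.
Qed.

End Step.

(** Two old points are separated by induction, two new ones by their letter at [v]. An old and a new
    point with equal patterns would put into [chi] a letter excluded by [step_x_fresh] or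
    [step_y_fresh]. *)
Lemma grown_separated S : grown S -> separated x S /\ separated y S.
Proof.
elim=> {S} [s|S s v gS [sepx sepy] sS sv].
  have win u : u \in window [fset s]%fset -> u + s \in flip_set d.
    by case/windowP=> t; rewrite inE => /eqP->.
  split=> u u' /win us /win us' /agreeP/(_ s); rewrite inE eqxx /shift.
    move=> /(_ isT) /(congr1 (site hflip)); rewrite !siteK //; exact: addIr.
  move=> /(_ isT); rewrite !(flip_pred hflip) // => /(can_inj (@ord_predK _)).
  by move=> /(congr1 (site hflip)); rewrite !siteK //; apply: addIr.
have S0 : S != fset0 by apply/fset0Pn; exists s.
split=> u u' uT u'T; rewrite agree_add => /andP[/eqP ev eS].
- case: (window_addP hflip uT) (window_addP hflip u'T) => [uS|[j fj uj]] [u'S|[j' fj' uj']].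
  + exact: sepx.
  + have [m mS mw] := occurs_in_window_y u S0.
    have /negP[] := step_x_fresh sS sv sepx sepy uS (agreexx _ _) mS mw.
    apply: fresh_chi; move: ev; rewrite /shift uj' subrK x_site => ->; first by [].
    by rewrite -uj' agree_sym.
  + have [m mS mw] := occurs_in_window_y u' S0.
    have /negP[] := step_x_fresh sS sv sepx sepy u'S (agreexx _ _) mS mw.
    apply: fresh_chi; move: ev; rewrite /shift uj subrK x_site => <-; first by [].
    by rewrite -uj.
  by move: ev; rewrite /shift uj uj' !subrK !x_site => ->.
have aux u1 u2 j : u1 \in window S -> fresh hflip S v j -> u2 = site hflip j - v ->
    y (u1 + v) = y (u2 + v) -> agree S (shift u1 y) (shift u2 y) -> u1 = u2.
  move=> u1S fj u2E ev1 eS1.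
  have [m mS mw] : exists2 m, m \in window S & agree S (shift m x) (shift u1 y).
    by apply/(balanced_occurs _ (@bal S)); exists u1; rewrite ?agreexx.
  have /negP[] := step_y_fresh sS sv sepx sepy mS mw u1S (agreexx _ _).
  rewrite ev1 u2E subrK y_site ord_predK; apply: fresh_chi => //.
  rewrite agree_sym; apply: agree_trans eS1 _; rewrite agree_sym u2E.
  exact: agree_off.
case: (window_addP hflip uT) (window_addP hflip u'T) => [uS|[j fj uj]] [u'S|[j' fj' uj']].
- exact: sepy.
- exact: aux fj' uj' ev eS.
- by apply: esym; apply: aux fj uj _ _ => //; rewrite agree_sym.
move: ev; rewrite /shift uj uj' !subrK !y_site.
by move=> /(can_inj (@ord_predK _)) ->.
Qed.

(* The successor map on the window, taking [u] to the [m] with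
   [agree S (shift m y) (shift u x)], is a single cycle. *)
Lemma grown_ergodic S (Q : configuration d 'I_d.+1 -> bool) :
  grown S -> local_on S Q ->
  (forall u, u \in window S -> Q (shift u x) = Q (shift u y)) ->
  forall u u', u \in window S -> u' \in window S ->
  Q (shift u x) = Q (shift u' x).
Proof.
move=> gS; elim: gS Q => {S} [s|S s v gS IH sS sv] Q loc inv.
  have win j : site hflip j - s \in window [fset s]%fset.
    by apply/windowP; exists s; rewrite ?fset11 // subrK site_flip.
  have winE u : u \in window [fset s]%fset -> exists j, u = site hflip j - s.
    case/windowP=> t; rewrite inE => /eqP-> us; exists (x (u + s)).
    by rewrite siteK // addrK.
  have Qpred j : Q (shift (site hflip (ord_pred j) - s) x) = Q (shift (site hflip j - s) x).
    rewrite [RHS]inv //; apply: loc; apply/agreeP => t; rewrite inE => /eqP->.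
    by rewrite /shift !subrK x_site y_site.
  move=> u u' /winE[j ->] /winE[j' ->].
  apply: (@ord_pred_ind _
    (fun k => Q (shift (site hflip k - s) x) = Q (shift (site hflip j' - s) x)) j') => // k.
  by rewrite Qpred.
have [sepx sepy] := grown_separated gS.
have S0 : S != fset0 by apply: grown_nonempty.
have step u m : u \in window S -> m \in window S ->
    agree S (shift m y) (shift u x) ->
    Q (shift u x) = Q (shift m y) /\ forall j, chi hflip S v (shift u x) j ->
    Q (shift (site hflip j - v) x) = Q (shift u x).
  move=> uS mS mu; set w := shift u x.
  have uw : agree S (shift u x) w by exact: agreexx.
  pose ext c : configuration d 'I_d.+1 := fun t => if t == v then c else w t.
  (* Invariance at the new points gives [psi (ord_pred j) = psi j] on [chi], so the arc relation
     equates [psi] at the two ends. *)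
  pose psi c := Q (ext c).
  have extE z : agree S z w -> Q z = psi (z v).
    move=> zw; apply: loc; rewrite agree_add /ext eqxx eqxx /=.
    apply/agreeP => t tS; case: eqP => [->//|_]; exact: (agreeP _ _ _ zw).
  have psi_chi j : chi hflip S v w j -> psi (ord_pred j) = psi j.
    case/andP=> fj jw; have jT : site hflip j - v \in window (v |` S)%fset.
      by apply/windowP; exists v; rewrite ?subrK ?site_flip // fset1U1.
    have := inv _ jT; rewrite !extE //; last first.
      by rewrite -(agree_eql _ (agree_off hflip fj)).
    by rewrite /shift subrK x_site y_site.
  have psi_ends : psi (x (u + v)) = psi (y (m + v)).
    have := step_arc v sepx sepy uS uw mS mu (fun j => (psi j)%:R).
    rewrite big1 ?addr0 => [|j _]; first by case: (psi _); case: (psi _).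
    by case: (boolP (chi hflip S v w j)) => [/psi_chi->|]; rewrite ?subrr ?mulr0 ?mul0r.
  split; first by rewrite !extE // /shift psi_ends.
  move=> j cj; rewrite !extE //; last by case/andP: cj.
  rewrite /shift subrK x_site; apply: contrapT => neq.
  (* A letter of [chi] with another value of [psi] would pass both properties to its predecessor,
     hence to all letters, one of which is not fresh. *)
  pose B k := chi hflip S v w k /\ psi k <> psi (x (u + v)).
  have [j0 j0f] := fresh_missing hflip sS sv.
  suff [] : B j0 by rewrite /chi (negPf j0f).
  apply: (@ord_pred_ind _ B j) => // k [ck nk]; split; last by rewrite psi_chi.
  have := step_arc_ends v sepx sepy uS uw mS mu (ord_pred k).
  rewrite ord_predK ck; case: eqP => [e|_]; last by case: chi => //; case: eqP.
  by case: nk; rewrite -psi_chi // e.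
(* [Q1] reads the value of [Q] from the pattern on [S] alone, which has a single position in the
   window; the induction hypothesis applies to it. *)
pose Q1 z := `[< exists2 u, u \in window S & agree S (shift u x) z && Q (shift u x) >].
have Q1E u : u \in window S -> Q1 (shift u x) = Q (shift u x).
  move=> uS; apply/asboolP/idP => [[u' u'S /andP[]]|Qu]; last first.
    by exists u; rewrite // agreexx.
  by move=> /(sepx _ _ u'S uS) ->.
have Q1loc : local_on S Q1.
  move=> z t zt; apply: asbool_equiv_eq; split=> -[u uS /andP[uz Qu]]; exists u => //.
    by rewrite (agree_trans uz zt).
  by rewrite (agree_trans uz) // agree_sym.
have Q1inv u : u \in window S -> Q1 (shift u x) = Q1 (shift u y).
  move=> uS; have [m mS mu] : exists2 m, m \in window S & agree S (shift m x) (shift u y).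
    by apply/(balanced_occurs _ (@bal S)); exists u; rewrite ?agreexx.
  rewrite -(Q1loc _ _ mu) !Q1E // inv; last first.
    by apply/fsubsetP: uS; apply: window_sub; apply: fsubsetUr.
  by have [-> _] := step m u mS uS (etrans (agree_sym _ _ _) mu).
have toS u : u \in window (v |` S)%fset ->
    exists2 u1, u1 \in window S & Q (shift u x) = Q (shift u1 x).
  case/(window_addP hflip) => [uS|[j fj ->]]; first by exists u.
  have [u1 u1S u1j] := occurs_in_window (site hflip j - v) S0.
  have [m mS mu] := occurs_in_window_y u1 S0.
  exists u1 => //; have [_] := step u1 m u1S mS mu; apply.
  by apply: fresh_chi; rewrite // agree_sym.
move=> u u' /toS[u1 u1S ->] /toS[u2 u2S ->].
by rewrite -!Q1E //; apply: IH.
Qed.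

End Balanced.

(** * The height function *)

(* A constant nonzero curl would make the increments along a 3-by-2 box too
   large for {0,1}-valued functions. *)
Lemma constant_curl (A B : nat -> nat -> int) (k : int) :
  (forall p q, 0 <= A p q <= 1) -> (forall p q, 0 <= B p q <= 1) ->
  (forall p q, A p q + B p.+1 q - B p q - A p q.+1 = k) -> k = 0.
Proof.
move=> Abd Bbd curl.
move: (curl 0%N 0%N) (curl 1%N 0%N) (curl 2%N 0%N)
  (curl 0%N 1%N) (curl 1%N 1%N) (curl 2%N 1%N).
move: (Abd 0%N 0%N) (Abd 1%N 0%N) (Abd 2%N 0%N) (Abd 0%N 2%N) (Abd 1%N 2%N) (Abd 2%N 2%N).
move: (Bbd 0%N 0%N) (Bbd 3%N 0%N) (Bbd 0%N 1%N) (Bbd 3%N 1%N).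
by lia.
Qed.

Section Height.

Variables (d : nat) (x y : configuration d 'I_d.+1).
Hypothesis hflip : flip_condition x y.

Definition rank (i : 'I_d) : 'I_d.+1 := x (- basis_vec i).

(** Splits a letter into [d] increments, one for each direction, whose sum is the letter ([sum_up]);
    they become the summands of [c_floor]. *)
Definition up (i : 'I_d) (z : configuration d 'I_d.+1) (n : lattice d) : int :=
  (rank i <= z n)%N.

Lemma basis_vec_neq0 (i : 'I_d) : basis_vec i != 0.
Proof. by apply/eqP => /rowP/(_ i); rewrite !mxE !eqxx. Qed.

Lemma basis_vec_inj : injective (@basis_vec d).
Proof.
move=> i j /rowP/(_ j); rewrite !mxE !eqxx /=.
by case: (j =P i) => [->|].
Qed.

Lemma rank_inj : injective rank.
Proof.
move=> i j e; apply: basis_vec_inj; apply: oppr_inj.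
have [_ inj _] := flip_bij hflip.
by apply: inj e; rewrite inE /= flip_setN.
Qed.

Lemma rank_neq0 i : rank i != ord0.
Proof.
rewrite -(flip_origin hflip); apply/eqP => e.
have [_ inj _] := flip_bij hflip.
have := basis_vec_neq0 i; rewrite -oppr_eq0 => /eqP; apply.
by apply: inj e; rewrite inE /= ?flip_setN ?flip_set0.
Qed.

Lemma sum_rank (a : 'I_d.+1) : (\sum_i (rank i <= a))%N = a :> nat.
Proof.
have rk i : exists k, lift ord0 k == rank i.
  case: (unliftP ord0 (rank i)) => [k ->|e]; first by exists k; rewrite eqxx.
  by have := rank_neq0 i; rewrite e eqxx.
pose s i := xchoose (rk i).
have sE i : rank i = lift ord0 (s i) by rewrite (eqP (xchooseP (rk i))).
have s_inj : injective s by move=> i j e; apply: rank_inj; rewrite !sE e.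
transitivity (\sum_(k < d) (k < a)%N)%N.
  rewrite [RHS](reindex_inj s_inj); apply: eq_bigr => i _.
  by rewrite sE /= /bump leq0n add1n.
have ad : (a <= d)%N by rewrite -ltnS.
have := @big_ord_widen _ _ addn a d (fun=> 1%N) ad.
move=> /(_ 0%N); rewrite big_const_ord iter_addn_0 mul1n.
by move=> e; rewrite [RHS]e [RHS]big_mkcond; apply: eq_bigr => k _; case: ltnP.
Qed.

Lemma up_bounds i z n : 0 <= up i z n <= 1.
Proof. by rewrite /up; case: leq. Qed.

Lemma up_shift i n z v : up i (shift n z) v = up i z (n + v).
Proof. by []. Qed.

Lemma sum_up z n : \sum_i up i z n = (z n : nat)%:Z.
Proof. by rewrite -[in RHS](sum_rank (z n)) (big_morph Posz PoszD (erefl _)). Qed.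

(** Going from a positive letter to its predecessor switches off only the indicator of the rank
    equal to it; going from 0 to [d] switches all on. So the forms of [x] and [y] differ by the
    coboundary of the point mass at 0. *)
Lemma up_diff i n :
  up i x n - up i y n = Posz (n + basis_vec i == 0)%R - Posz (n == 0)%R :> int.
Proof.
have [nF|nF] := boolP (n \in flip_set d); last first.
  rewrite /up (flip_off hflip nF) subrr addr_eq0.
  case: eqP => [e|_]; first by rewrite e flip_setN in nF.
  case: eqP => [e|_]; last by rewrite subrr.
  by rewrite e flip_set0 in nF.
rewrite /up (flip_pred hflip nF).
have := rank_neq0 i; rewrite -val_eqE /= => ri.
case/flip_setP: nF => [->|[j ->]].
  rewrite (flip_origin hflip) add0r eqxx (negPf (basis_vec_neq0 i)) /=.
  rewrite leqn0 (negPf ri) modn_small //.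
  by have := ltn_ord (rank i); rewrite ltnS => ->.
rewrite oppr_eq0 (negPf (basis_vec_neq0 j)) [- basis_vec j + _]addrC subr_eq0.
rewrite (inj_eq basis_vec_inj).
rewrite -(inj_eq rank_inj) -[x (- basis_vec j)]/(rank j) -val_eqE /=.
have := rank_neq0 j; rewrite -val_eqE /= => rj.
have -> : ((rank j + d.+1).-1 %% d.+1 = (rank j).-1)%N.
  rewrite (_ : _.-1 = (rank j).-1 + d.+1)%N; last by lia.
  rewrite modnDr modn_small //; apply: leq_ltn_trans (leq_pred _) (ltn_ord _).
by lia.
Qed.

Hypothesis bal : forall S, balanced x y S.

Lemma ergodic S (Q : configuration d 'I_d.+1 -> bool) :
  grown S -> local_on S Q ->
  (forall u, u \in window S -> Q (shift u x) = Q (shift u y)) ->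
  forall n m, Q (shift n x) = Q (shift m x).
Proof.
move=> gS loc inv n m; have S0 := grown_nonempty gS.
have [u uS /loc <-] := occurs_in_window hflip bal n S0.
have [w wS /loc <-] := occurs_in_window hflip bal m S0.
exact: (grown_ergodic hflip bal gS loc inv uS wS).
Qed.

(** The curl is a local function, equal for [x] and [y] since their forms differ by a coboundary. It
    is thus constant by [ergodic], and zero by [constant_curl]. *)
Lemma up_closed i j n : up i x n + up j x (n + basis_vec i) =
  up j x n + up i x (n + basis_vec j) :> int.
Proof.
pose Psi (z : configuration d 'I_d.+1) : int :=
  up i z 0 + up j z (basis_vec i) - up j z 0 - up i z (basis_vec j).
pose S := (basis_vec j |` (basis_vec i |` [fset 0%R]))%fset.
have gS : grown S.
  have adj k : lattice_adj (0 : lattice d) (basis_vec k).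
    by have := adj_basis 0 k; rewrite add0r.
  apply: grown_add (adj j); last by rewrite !inE eqxx orbT.
  by apply: grown_add (adj i); rewrite ?inE ?eqxx //; apply: grown_seed.
have shiftE z m : Psi (shift m z) = up i z m + up j z (m + basis_vec i)
    - up j z m - up i z (m + basis_vec j) :> int.
  by rewrite /Psi /up /shift addr0.
have loc : local_on S Psi.
  move=> z w /agreeP zw; rewrite /Psi /up !zw //; rewrite !inE eqxx ?orbT //.
have curl m : Psi (shift m x) = Psi (shift 0 x).
  apply/eqP; rewrite (@ergodic S (fun z => Psi z == Psi (shift 0 x)) gS _ _ m 0) //.
    by move=> z w zw; rewrite (loc _ _ zw).
  move=> u _; congr (_ == _); rewrite !shiftE.
  have := up_diff i u; have := up_diff j u.
  have := up_diff i (u + basis_vec j); have := up_diff j (u + basis_vec i).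
  have -> : u + basis_vec j + basis_vec i = u + basis_vec i + basis_vec j.
    by rewrite addrAC.
  move: (Posz (u + basis_vec i + basis_vec j == 0)%R) (Posz (u + basis_vec i == 0)%R)
    (Posz (u + basis_vec j == 0)%R) (Posz (u == 0)%R) => *; lia.
suff : Psi (shift n x) = 0 by rewrite shiftE; lia.
rewrite curl; pose pt p q : lattice d := basis_vec i *+ p + basis_vec j *+ q.
apply: (@constant_curl (fun p q => up i x (pt p q)) (fun p q => up j x (pt p q)))
  => p q; try exact: up_bounds.
rewrite -(curl (pt p q)) shiftE /pt !mulrSr.
by rewrite (addrAC _ _ (basis_vec j *+ q)) addrA.
Qed.

Lemma height_exists : exists2 H : lattice d -> int, H 0%R = 0 :> int &
  forall i n, H (n + basis_vec i) - H n = up i x n :> int.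
Proof.
have [H HE] := lattice_potential up_closed.
exists (fun n => H n - H 0) => [|i n]; first by rewrite subrr.
by rewrite -HE; lia.
Qed.

Section Quasi.

Variable H : lattice d -> int.
Hypothesis Hx : forall i n, H (n + basis_vec i) - H n = up i x n :> int.

Let H' n : int := H n - Posz (n == 0)%R.

Lemma height_y i n : H' (n + basis_vec i) - H' n = up i y n :> int.
Proof.
have := up_diff i n; rewrite -Hx /H'.
by move: (Posz _) (Posz _) (H _) (H _) => *; lia.
Qed.

(** The increment along [v] is a signed sum of [up] over a path from 0 to [v]; the same sum read in
    [y] gives the increment of [H']. *)
Lemma increment_local v : exists S (Phi : configuration d 'I_d.+1 -> int),
  [/\ grown S, 0 \in S, v \in S, local_on S Phi &
   forall n, Phi (shift n x) = H (n + v) - H n :> int /\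
             Phi (shift n y) = H' (n + v) - H' n :> int].
Proof.
elim/lattice_ind: v => [|v i|v i].
- exists [fset 0%R]%fset, (fun=> 0); rewrite inE eqxx.
  by split=> // [|n]; [apply: grown_seed|rewrite addr0 !subrr].
- case=> S [Phi [gS S0 vS loc PhiE]].
  exists ((v + basis_vec i)%R |` S)%fset, (fun z => Phi z + up i z v).
  rewrite !in_fset1U eqxx S0 orbT; split=> //.
  + exact: grown_add gS vS (adj_basis v i).
  + move=> z w; rewrite agree_add => /andP[_ zw].
    by rewrite (loc _ _ zw) /up ((agreeP _ _ _ zw) v vS).
  move=> n; have [Px Py] := PhiE n; have := Hx i (n + v); have := height_y i (n + v).
  rewrite Px Py !up_shift => <- <-.
  have -> : n + (v + basis_vec i) = n + v + basis_vec i by rewrite addrA.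
  by split; lia.
case=> S [Phi [gS S0 vS loc PhiE]].
exists ((v - basis_vec i)%R |` S)%fset, (fun z => Phi z - up i z (v - basis_vec i)).
rewrite !in_fset1U eqxx S0 orbT; split=> //.
- apply: grown_add gS vS _; rewrite lattice_adj_sym.
  by have := adj_basis (v - basis_vec i) i; rewrite subrK.
- move=> z w; rewrite agree_add => /andP[/eqP zwv zw].
  by rewrite (loc _ _ zw) /up zwv.
move=> n; have [Px Py] := PhiE n.
have := Hx i (n + v - basis_vec i); have := height_y i (n + v - basis_vec i).
rewrite subrK Px Py !up_shift.
have -> : n + (v - basis_vec i) = n + v - basis_vec i by rewrite addrA.
move=> <- <-; by split; lia.
Qed.

Hypothesis H0 : H 0%R = 0 :> int.

(** The increments of [H] and [H'] along [v] differ only at 0 and [-v]. At 0 they are [H v] and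
    [H v + 1], so balance forces [H v + 1] to be the increment of [H] at [-v]. *)
Lemma height_opp v : v != 0 -> H (- v) = - H v - 1 :> int.
Proof.
move=> v0; have [S [Phi [gS S0 vS loc PhiE]]] := increment_local v.
pose test (z : configuration d 'I_d.+1) : int := (Phi z == H v + 1)%:R.
have loc1 : local_on S test by move=> z w zw; rewrite /test (loc _ _ zw).
have := bal loc1; rewrite /test.
rewrite (big_fsetD1 0) /=; last first.
  by apply/windowP; exists 0; rewrite // addr0 flip_set0.
rewrite (big_fsetD1 (- v)) /=; last first.
  rewrite !inE oppr_eq0 v0 /=; apply/windowP; exists v; rewrite // addNr flip_set0 //.
rewrite big_seq big1 ?addr0; last first.
  move=> u; rewrite !inE => /and3P[uv u0 _]; have [-> ->] := PhiE u.
  rewrite /H' (negPf u0) addr_eq0 (negPf uv) !subr0 subrr //.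
have [-> ->] := PhiE 0; have [-> ->] := PhiE (- v).
rewrite /H' !add0r addNr oppr_eq0 (negPf v0) eqxx H0.
by lia.
Qed.

(** The increment along [v] being [H v] or [H v + 1] is a condition that agrees for [x] and [y]: at
    0 and [-v] they merely show these two values in opposite orders. It holds at 0, hence
    everywhere. *)
Lemma height_quasi u v : 0 <= H (u + v) - H u - H v <= 1.
Proof.
have [->|v0] := eqVneq v 0; first by rewrite addr0 H0; lia.
have [S [Phi [gS S0 vS loc PhiE]]] := increment_local v.
pose Q z := (Phi z == H v) || (Phi z == H v + 1).
have : Q (shift u x).
  rewrite (@ergodic S Q gS _ _ u 0).
  - by rewrite /Q (PhiE 0).1 add0r H0 subr0 eqxx.
  - by move=> z w zw; rewrite /Q (loc _ _ zw).
  move=> w _; rewrite /Q; have [-> ->] := PhiE w; rewrite /H'.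
  have [->|w0] := eqVneq w 0; first by rewrite add0r (negPf v0) H0; lia.
  rewrite addr_eq0; have [->|wv] := eqVneq w (- v).
    by rewrite addNr H0 height_opp //; lia.
  by rewrite !subr0.
by rewrite /Q (PhiE u).1; lia.
Qed.

End Quasi.

End Height.

(** * From quasi-additive heights to a slope *)

Section Dot.

Variables (R : realType) (d : nat) (alpha : 'rV[R]_d).

Lemma dotZD u v : dotZ (u + v) alpha = dotZ u alpha + dotZ v alpha.
Proof.
rewrite /dotZ -big_split; apply: eq_bigr => i _.
by rewrite mxE intrD mulrDl.
Qed.

Lemma dotZN u : dotZ (- u) alpha = - dotZ u alpha.
Proof.
by rewrite /dotZ -sumrN; apply: eq_bigr => i _; rewrite mxE intrN mulNr.
Qed.

Lemma dotZ0 : dotZ 0 alpha = 0.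
Proof. by rewrite /dotZ big1 // => i _; rewrite mxE mul0r. Qed.

Lemma dotZ_basis i : dotZ (basis_vec i) alpha = alpha 0 i.
Proof.
rewrite /dotZ (bigD1 i) //= mxE !eqxx mul1r big1 ?addr0 // => j ji.
by rewrite mxE (negPf ji) mul0r.
Qed.

Lemma dotZMn u k : dotZ (u *+ k) alpha = dotZ u alpha *+ k.
Proof.
by elim: k => [|k IH]; rewrite ?mulr0n ?dotZ0 // !mulrS dotZD IH.
Qed.

End Dot.

Section QuasiLinear.

Variables (R : realType) (d : nat) (H : lattice d -> int).
Hypothesis quasi : forall u v, 0 <= H (u + v) - H u - H v <= 1.

Lemma quasi_mul u k : H u * k.+1%:Z <= H (u *+ k.+1) <= H u * k.+1%:Z + k%:Z.
Proof.
elim: k => [|k IH]; first by rewrite mulr1n mulr1 addr0 lexx.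
have -> : u *+ k.+2 = u *+ k.+1 + u by rewrite mulrSr.
by have := quasi (u *+ k.+1) u; move: IH; move: (H _) (H _) (H _) => *; nia.
Qed.

(** Both heights are compared with that of [u *+ (k.+1 * l.+1)], cut into blocks in two ways. *)
Lemma quasi_cross u k l :
  H (u *+ k.+1) * l.+1%:Z <= (H (u *+ l.+1) + 1) * k.+1%:Z.
Proof.
have := quasi_mul (u *+ k.+1) l; have := quasi_mul (u *+ l.+1) k.
rewrite -!mulrnA (mulnC l.+1).
by move: (H _) (H _) (H _) => *; nia.
Qed.

(** The asymptotic height per step; superadditivity of [H] allows a supremum in place of a limit. *)
Definition slope u : R := sup [set (H (u *+ k.+1))%:~R / k.+1%:R | k in setT].

Lemma slope_bounds u k :
  (H (u *+ k.+1))%:~R <= slope u * k.+1%:R <= (H (u *+ k.+1))%:~R + 1.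
Proof.
rewrite /slope; set E := (X in sup X).
have ubE l : ubound E (((H (u *+ l.+1))%:~R + 1) / l.+1%:R).
  move=> _ [m _ <-]; rewrite ler_pdivrMr // mulrAC ler_pdivlMr //.
  have := quasi_cross u m l; rewrite -(ler_int R) !intrM intrD.
  by rewrite !pmulrn.
have E0 : E !=set0 by exists ((H (u *+ 1))%:~R / 1%:R), 0%N.
apply/andP; split.
  rewrite -ler_pdivrMr //; apply: sup_upper_bound; last by exists k.
  by split=> //; exists (((H (u *+ 1))%:~R + 1) / 1%:R); apply: (ubE 0%N).
by rewrite -ler_pdivlMr //; apply: ge_sup.
Qed.

Lemma slopeD u v : slope (u + v) = slope u + slope v.
Proof.
apply/eqP; rewrite eq_le; apply/andP.
(* The three slope bounds and quasi-additivity cost at most 1 each, hence 4; a bound uniform in the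
   scale [k.+1] excludes a positive error. *)
suff small e : (forall k : nat, e * k.+1%:R <= 4 :> R) -> e <= 0.
  have est k : `|slope (u + v) * k.+1%:R - slope u * k.+1%:R - slope v * k.+1%:R| <= 4.
    have := slope_bounds (u + v) k; have := slope_bounds u k; have := slope_bounds v k.
    have := quasi (u *+ k.+1) (v *+ k.+1); rewrite -mulrnDl.
    rewrite -!(ler_int R) !intrB ler_norml.
    by lra.
  by split; rewrite -subr_le0; apply: small => k; have := est k;
    rewrite ler_norml; lra.
move=> bd; rewrite leNgt; apply/negP => e0.
have := archi_boundP (ltW (divr_gt0 (ltr0n R 4) e0)).
rewrite ltr_pdivrMr // mulrC => lt4.
by have := bd (Num.bound (4 / e)); rewrite -natr1 mulrDr mulr1; lra.
Qed.

Lemma quasi_linear : exists alpha : 'rV[R]_d,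
  forall v, (H v)%:~R <= dotZ v alpha <= (H v)%:~R + 1.
Proof.
exists (\row_i slope (basis_vec i)) => v.
suff -> : dotZ v (\row_i slope (basis_vec i)) = slope v.
  by have := slope_bounds v 0; rewrite mulr1n mulr1.
have slopeB u i : slope (u - basis_vec i) = slope u - slope (basis_vec i).
  by apply/eqP; rewrite eq_sym subr_eq -slopeD subrK.
elim/lattice_ind: v => [|v i|v i].
- by rewrite dotZ0; have := slopeD 0 0; rewrite addr0; lra.
- by rewrite slopeD dotZD dotZ_basis mxE => ->.
by rewrite slopeB dotZD dotZN dotZ_basis mxE => ->.
Qed.

End QuasiLinear.

(** * Total irrationality and the rotation coding *)

Lemma common_denominator (n : nat) (q : 'I_n -> rat) :
  exists2 D : int, D != 0 &
    exists z : 'I_n -> int, forall i, q i * D%:~R = (z i)%:~R.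
Proof.
exists (\prod_j denq (q j)); first by apply/prodf_neq0 => j _; apply: denq_neq0.
exists (fun i => numq (q i) * \prod_(j | j != i) denq (q j)) => i.
rewrite (bigD1 i) //= !intrM mulrA -{1}(divq_num_den (q i)) divfK //.
by rewrite intr_eq0 denq_neq0.
Qed.

Lemma totally_irrational_lattice (R : realType) (d : nat) (alpha : 'rV[R]_d) :
  (forall (v : lattice d) (q : int), dotZ v alpha = q%:~R -> v = 0) ->
  totally_irrational alpha.
Proof.
move=> irr q0 q rel.
have [D D0 [z zE]] := common_denominator q.
pose E := denq q0; have E0 : E != 0 by apply: denq_neq0.
have zR i : ratr (q i) * D%:~R = (z i)%:~R :> R.
  by rewrite -!(ratr_int R) -rmorphM zE.
have q0R : ratr q0 * E%:~R = (numq q0)%:~R :> R.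
  by rewrite -!(ratr_int R) -rmorphM -{1}(divq_num_den q0) divfK // intr_eq0.
(* Clearing denominators turns the relation into a lattice vector whose product with [alpha] is an
   integer. *)
have : \row_i (z i * E) = 0 :> lattice d.
  apply: (irr _ (- (numq q0 * D))).
  rewrite /dotZ intrN intrM -q0R.
  transitivity ((\sum_(i < d) ratr (q i) * alpha 0 i) * (D%:~R * E%:~R)).
    rewrite mulr_suml; apply: eq_bigr => i _.
    by rewrite mxE intrM -zR mulrACA [RHS]mulrC; ring.
  move/eqP: rel; rewrite mulr1 addrC addr_eq0 => /eqP->; ring.
move/rowP => zE0; have q_0 i : q i = 0.
  have := zE0 i; rewrite !mxE => /eqP; rewrite mulf_eq0 (negPf E0) orbF => /eqP zi.
  by have /eqP := zE i; rewrite zi mulf_eq0 intr_eq0 (negPf D0) orbF => /eqP.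
split=> //; move: rel; rewrite big1 => [|i _]; last by rewrite q_0 rmorph0 mul0r.
by rewrite mulr1 addr0 => /eqP; rewrite fmorph_eq0 => /eqP.
Qed.

Section Sturmian.

Variables (R : realType) (d : nat) (x y : configuration d 'I_d.+1).
Hypothesis hflip : flip_condition x y.
Hypothesis recx : uniformly_recurrent x.
Hypothesis bal : forall S, balanced x y S.

Variable H : lattice d -> int.
Hypothesis H0 : H 0%R = 0 :> int.
Hypothesis Hx : forall i n, H (n + basis_vec i) - H n = up x i x n :> int.

Variable alpha : 'rV[R]_d.
Hypothesis Halpha : forall v, (H v)%:~R <= dotZ v alpha <= (H v)%:~R + 1.

(* Along a line of direction [v], the excess of the height over [q] per step is
   nondecreasing and bounded by 1, whereas the step from [-v] to 0, where it
   increases, recurs infinitely often on one of finitely many such lines. *)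
Lemma no_resonance v (q : int) :
  v != 0 -> dotZ v alpha = q%:~R -> H v = q -> False.
Proof.
move=> v0 vq Hv.
have quasi := height_quasi hflip bal Hx H0.
have [S [Phi [gS S0 vS loc PhiE]]] := increment_local hflip Hx v.
pose E n (k : nat) : int := H (n + v *+ k) - q * k%:Z.
have ES n k : E n k.+1 - E n k = Phi (shift (n + v *+ k) x) - q.
  rewrite (PhiE _).1 /E.
  have -> : n + v *+ k.+1 = n + v *+ k + v by rewrite mulrSr addrA.
  by move: (H _) (H _) => *; lia.
have Emono n k : E n k <= E n k.+1.
  have := ES n k; have := quasi (n + v *+ k) v.
  by rewrite (PhiE _).1 Hv; move: (H _) (H _) => *; lia.
have Ele n k l : (k <= l)%N -> E n k <= E n l.
  move/subnK <-; elim: (l - k)%N => [|m IH]; first by rewrite add0n lexx.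
  by apply: le_trans IH _; rewrite addSn Emono.
have Ebd n k : E n k <= E n 0%N + 1.
  have : (H (v *+ k) <= q * k%:Z).
    rewrite -(ler_int R) intrM -vq.
    by have /andP[+ _] := Halpha (v *+ k); rewrite dotZMn -mulr_natr pmulrn.
  by have := quasi n (v *+ k); rewrite /E mulr0n addr0; move: (H _) (H _) => *; lia.
pose p := [ffun s : S => shift (- v) x (val s)].
have pocc n : occ p x n -> Phi (shift n x) = q + 1.
  move=> pn; transitivity (Phi (shift (- v) x)).
    apply: loc; apply/agreeP => s sS.
    by have := pn [` sS]%fset; rewrite /p ffunE.
  by rewrite (PhiE _).1 addNr H0 (height_opp hflip bal Hx H0 v0) Hv; lia.
have [|K Krec] := @recx S p.
  by exists (- v) => s; rewrite /p ffunE.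
(* There is one more time [t] than points in [K], so two times share a line, on which the excess
   would rise by 2, against [Ebd]. *)
have Kex (t : 'I_(#|{: K}|).+1) : exists k : K, Phi (shift (val k + v *+ t) x) == q + 1.
  have [k kK kocc] := Krec (v *+ t).
  by exists [` kK]%fset; rewrite /= addrC pocc.
suff inj : injective (fun t => xchoose (Kex t)).
  by have := leq_card _ inj; rewrite card_ord ltnn.
have far (t t' : 'I_(#|{: K}|).+1) : (t < t')%N -> xchoose (Kex t) <> xchoose (Kex t').
  move=> tt' e; have := xchooseP (Kex t'); have := xchooseP (Kex t).
  rewrite -e; set n := val _ => /eqP Pt /eqP Pt'.
  have := ES n t; have := ES n t'; rewrite Pt Pt'.
  by have := Ebd n t'.+1; have := Ele n t.+1 t' tt'; have := Ele n 0%N t (leq0n t); lia.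
move=> t t' e; apply: val_inj => /=.
by case: (ltngtP t t') => // lt; case: (far _ _ lt).
Qed.

(** If [H v] is not [q], it is [q - 1], and [height_opp] then puts [-v] in the resonant case. *)
Lemma dotZ_int v (q : int) : dotZ v alpha = q%:~R -> v = 0.
Proof.
move=> vq; apply/eqP/negPn/negP => v0.
have [e|ne] := eqVneq (H v) q; first exact: no_resonance v0 vq e.
apply: (@no_resonance (- v) (- q)); rewrite ?oppr_eq0 ?dotZN ?vq ?intrN //.
rewrite (height_opp hflip bal Hx H0 v0).
have := Halpha v; rewrite vq -[1]/(1%:~R) -intrD !ler_int => bd.
by move/eqP: ne; lia.
Qed.

Lemma floor_dotZ v : Num.floor (dotZ v alpha) = H v.
Proof.
apply: floor_def; have /andP[-> le] := Halpha v; rewrite /= lt_neqAle.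
rewrite intrD le andbT; apply/eqP => e.
have := @dotZ_int v (H v + 1); rewrite intrD => /(_ e) v0.
by move: e; rewrite v0 dotZ0 H0 add0r => /eqP; rewrite eq_sym oner_eq0.
Qed.

(** For nonzero [v] the lower bound is not attained. The right side is the height of [y] plus 1, a
    constant that cancels in differences. *)
Lemma ceil_dotZ v : Num.ceil (dotZ v alpha) = H v - Posz (v == 0)%R + 1.
Proof.
have [->|v0] := eqVneq v 0; first by rewrite dotZ0 ceil0 H0.
rewrite subr0; apply: ceil_def; rewrite addrK intrD; have /andP[le ->] := Halpha v.
rewrite andbT lt_neqAle le andbT; apply: contra v0 => /eqP e.
by apply/eqP; apply: (@dotZ_int v (H v)).
Qed.

Lemma sturmian_of_height :
  [/\ forall i, 0 <= alpha 0 i < 1, totally_irrational alpha,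
      forall n, (x n : nat)%:Z = c_floor alpha n
    & forall n, (y n : nat)%:Z = c_ceil alpha n].
Proof.
split.
- move=> i; have := floor_dotZ (basis_vec i); rewrite dotZ_basis.
  have := Hx i 0; rewrite add0r H0 subr0 /up (flip_origin hflip) leqn0.
  have := rank_neq0 hflip i; rewrite -val_eqE /= => /negPf -> -> /eqP.
  by rewrite floor_eq.
- exact: totally_irrational_lattice dotZ_int.
- move=> n; rewrite /c_floor -(sum_up hflip); apply: eq_bigr => i _.
  by rewrite -dotZ_basis -dotZD !floor_dotZ (addrC (basis_vec i)) Hx.
move=> n; rewrite /c_ceil -(sum_up hflip); apply: eq_bigr => i _.
rewrite -dotZ_basis -dotZD !ceil_dotZ (addrC (basis_vec i)).
by rewrite -(height_y hflip Hx) [in RHS]opprD addrACA subrr addr0.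
Qed.

End Sturmian.

(** * Occurrences and languages *)

Section Patterns.

Variables (d : nat).
Implicit Types (S T : {fset lattice d}) (z : configuration d 'I_d.+1).

Definition extend S (p : {ffun S -> 'I_d.+1}) : configuration d 'I_d.+1 :=
  fun u => if insub u is Some s then p s else ord0.

Definition pattern S z : {ffun S -> 'I_d.+1} := [ffun s => z (val s)].

Lemma extend_pattern S z : agree S (extend (pattern S z)) z.
Proof.
apply/agreeP => s sS; rewrite /extend insubT /pattern ffunE.
by rewrite SubK.
Qed.

Lemma agree_extend S z p : agree S z (extend p) = (pattern S z == p).
Proof.
apply/agreeP/eqP => [zp|<- s sS].
  apply/ffunP => s; rewrite ffunE zp ?(valP s) //.
  by rewrite /extend valK.
by rewrite ((agreeP _ _ _ (extend_pattern S z)) s sS).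
Qed.

Lemma occE S (p : {ffun S -> 'I_d.+1}) z u :
  occ p z u <-> agree S (shift u z) (extend p).
Proof.
rewrite agree_extend; split=> [up|/eqP<- s]; last by rewrite ffunE.
by apply/eqP/ffunP => s; rewrite ffunE up.
Qed.

Definition language S z : {fset {ffun S -> 'I_d.+1}} :=
  [fset p in {ffun S -> 'I_d.+1} | `[< lang S z p >]]%fset.

Lemma languageP S z p :
  reflect (exists n, agree S (shift n z) (extend p)) (p \in language S z).
Proof.
rewrite in_fset !inE /=; apply: (iffP (asboolP _)) => -[n np].
  by exists n; apply/occE.
by exists n; apply/occE.
Qed.

Lemma lang_language S z : lang S z = [set` language S z].
Proof.
apply/seteqP; split=> p /=.
  by case=> n /occE np; apply/languageP; exists n.
by case/languageP=> n /occE np; exists n.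
Qed.

Lemma pattern_language S z n : pattern S (shift n z) \in language S z.
Proof. by apply/languageP; exists n; rewrite agree_extend. Qed.

Lemma sum_extend (V : pzRingType) S (L : {fset {ffun S -> 'I_d.+1}}) z
    (theta : configuration d 'I_d.+1 -> V) :
  local_on S theta -> pattern S z \in L ->
  \sum_(q : L) (agree S z (extend (val q)))%:R * theta (extend (val q)) = theta z.
Proof.
move=> loc zL; rewrite (bigD1 [` zL]%fset) //= agree_extend eqxx mul1r.
rewrite (loc _ _ (extend_pattern S z)) big1 ?addr0 // => q qz.
rewrite agree_extend; case: eqP => [e|]; last by rewrite mul0r.
by case/eqP: qz; apply: val_inj; apply: esym.
Qed.

End Patterns.

Lemma grown_cover (d : nat) (S : {fset lattice d}) :
  exists2 T, grown T & (S `<=` T)%fset.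
Proof.
elim/fset1U_rect: S => [|w S _ [T gT ST]].
  by exists [fset 0%R]%fset; [apply: grown_seed|apply: fsub0set].
have /fset0Pn[s sT] := grown_nonempty gT.
have [||T' [[gT' TT'] _ wT']] := @growth_reaches d
  (fun T' => grown T' /\ (T `<=` T')%fset) T s _ _ sT w.
- move=> T' t v [gT' TT'] tT' tv; split; first exact: grown_add gT' tT' tv.
  exact: fsubset_trans TT' (fsubsetUr _ _).
- by split.
by exists T' => //; rewrite fsubUset fsub1set wT' (fsubset_trans ST).
Qed.

Lemma fset_avoid (d : nat) (hd : (1 <= d)%N) (E : {fset lattice d}) :
  exists u, u \notin E.
Proof.
pose i := Ordinal hd; pose N := (\sum_(w <- E) `|w 0%R i|)%N.
exists (basis_vec i *+ N.+1); apply/negP => uE.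
suff: (N.+1 <= N)%N by rewrite ltnn.
rewrite {2}/N (big_fsetD1 _ uE) /=; apply: leq_trans (leq_addr _ _).
by rewrite mulmxnE mxE !eqxx -mulrnA mul1n natz.
Qed.

(** * Pattern counts, unique occurrences and balance *)

Section Bridge.

Variables (d : nat) (x y : configuration d 'I_d.+1).
Hypothesis hflip : flip_condition x y.
Implicit Types (S T : {fset lattice d}) (z : configuration d 'I_d.+1).

Definition occurrences S z w : {fset lattice d} :=
  [fset u in window S | agree S (shift u z) w]%fset.

Lemma occ_diff S (p : {ffun S -> 'I_d.+1}) :
  occ p x `\` occ p y = [set` occurrences S x (extend p)] /\
  occ p y `\` occ p x = [set` occurrences S y (extend p)].
Proof.
have diff z w : (forall u, (u \in window S) = ~~ agree S (shift u z) (shift u w)) ->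
    occ p z `\` occ p w = [set` occurrences S z (extend p)].
  move=> win; apply/seteqP; split=> u /=; rewrite in_fset !inE /=.
    case=> /occE uz nuw; rewrite uz andbT win; apply/negP => e; apply: nuw.
    by apply/occE; rewrite -(agree_eql _ e).
  case/andP=> uS uz; split; first exact/occE.
  by move=> /occE uw; move: uS; rewrite win (agree_eql _ uz) agree_sym uw.
split; apply: diff => u; first exact: window_agree.
by rewrite agree_sym; apply: window_agree.
Qed.

Lemma card_occurrences S z w :
  #|` occurrences S z w|%:R =
  \sum_(u <- window S) (agree S (shift u z) w)%:R :> int.
Proof.
rewrite card_fset_sum1 big_fset /= natr_sum [LHS]big_mkcond.
by apply: eq_bigr => u _; case: agree.
Qed.

Lemma balancedP S : balanced x y S <-> forall p : {ffun S -> 'I_d.+1},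
  #|` occurrences S x (extend p)| = #|` occurrences S y (extend p)|.
Proof.
split=> [bal p|cnt Phi loc].
  have loc : local_on S (fun z => (agree S z (extend p))%:R : int).
    by move=> z w zw; rewrite (agree_eql _ zw).
  apply/eqP; rewrite -(eqr_nat int) !card_occurrences -subr_eq0 -sumrB.
  exact/eqP/(bal _ loc).
rewrite sumrB; apply/eqP; rewrite subr_eq0; apply/eqP.
have sumE z : \sum_(u <- window S) Phi (shift u z) =
    \sum_(p : {ffun S -> 'I_d.+1}) Phi (extend p) * #|` occurrences S z (extend p)|%:R.
  transitivity (\sum_(u <- window S) \sum_(p : {ffun S -> 'I_d.+1}) Phi (extend p) *
      (agree S (shift u z) (extend p))%:R).
    apply: eq_bigr => u _; rewrite (bigD1 (pattern S (shift u z))) //=.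
    rewrite agree_extend eqxx mulr1 (loc _ _ (extend_pattern _ _)) big1 ?addr0 //.
    by move=> p /negPf pz; rewrite agree_extend eq_sym pz mulr0.
  rewrite exchange_big; apply: eq_bigr => p _.
  by rewrite card_occurrences mulr_sumr.
by rewrite !sumE; apply: eq_bigr => p _; rewrite cnt.
Qed.

Lemma indistinguishable_balanced : asymptotic x y ->
  indistinguishable x y <-> forall S, balanced x y S.
Proof.
move=> hxy; split=> [[_ ind] S|bal].
  apply/balancedP => p; have := ind S p; have [-> ->] := occ_diff p.
  move=> e; apply/esym/card_eq_fsetP; rewrite card_eq_sym.
  by apply: card_eq_trans e; rewrite card_eq_sym; apply/card_eq_fsetP.
split=> // S p; have [-> ->] := occ_diff p.
have /card_eq_fsetP := (balancedP S).1 (bal S) p.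
by move/card_eq_trans; apply; rewrite card_eq_sym; apply/card_eq_fsetP.
Qed.

Lemma balanced_cover :
  (forall S, grown S -> balanced x y S) -> forall S, balanced x y S.
Proof.
move=> bal S; have [T gT ST] := grown_cover S.
exact: (balanced_sub hflip ST (bal T gT)).
Qed.

Definition unique_occurrences := forall S, S != fset0 -> connected_fset S ->
  forall p : {ffun S -> 'I_d.+1}, (lang S x `|` lang S y) p ->
  (occ p x `\` occ p y) #= `I_1 /\ (occ p y `\` occ p x) #= `I_1.

Lemma unique_balanced : unique_occurrences -> forall S, balanced x y S.
Proof.
move=> uniq; apply: balanced_cover => S gS; apply/balancedP => p.
have [Lp|nLp] := pselect ((lang S x `|` lang S y) p).
  have := uniq S (grown_nonempty gS) (grown_connected gS) p Lp.
  by have [-> ->] := occ_diff p; case=> /card_eq_fsetP-> /card_eq_fsetP->.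
have none z : ~ lang S z p -> #|` occurrences S z (extend p)| = 0%N.
  move=> nz; apply/eqP; rewrite cardfs_eq0; apply/eqP/fsetP => u.
  rewrite in_fset !inE; apply/negP => /andP[_ /occE uz]; apply: nz; by exists u.
by rewrite !none // => Lp; apply: nLp; [right|left].
Qed.

Section FromBalanced.

Hypothesis bal : forall S, balanced x y S.

Lemma language_window S p : S != fset0 -> (lang S x `|` lang S y) p ->
  (exists2 u, u \in window S & agree S (shift u x) (extend p)) /\
  (exists2 u, u \in window S & agree S (shift u y) (extend p)).
Proof.
move=> S0 Lp.
suff Wx : exists2 u, u \in window S & agree S (shift u x) (extend p).
  by split=> //; apply/(balanced_occurs _ (@bal S)).
have onx n : agree S (shift n x) (extend p) ->
    exists2 u, u \in window S & agree S (shift u x) (extend p).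
  move=> np; have [u uS un] := occurs_in_window hflip bal n S0.
  by exists u => //; apply: agree_trans un np.
case: Lp => -[n /occE np]; first exact: onx np.
have [nS|nS] := boolP (n \in window S).
  by apply/(balanced_occurs _ (@bal S)); exists n.
by apply: (onx n); rewrite (agree_eql _ (agree_off hflip nS)).
Qed.

Lemma balanced_unique : unique_occurrences.
Proof.
move=> S S0 conn p Lp.
have [sepx sepy] := grown_separated hflip bal (connected_grown S0 conn).
have one z : separated z S ->
    (exists2 u, u \in window S & agree S (shift u z) (extend p)) ->
    [set` occurrences S z (extend p)] #= `I_1.
  move=> sep [u uS up]; apply/card_eq_fsetP.
  suff -> : occurrences S z (extend p) = [fset u]%fset by rewrite cardfs1.
  apply/fsetP => w; rewrite in_fset !inE; apply/andP/eqP => [[wS wp]|->//].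
  apply: sep => //; apply: agree_trans wp _; by rewrite agree_sym.
have [Wx Wy] := language_window S0 Lp; have [-> ->] := occ_diff p.
by split; apply: one.
Qed.

(** Since every pattern occurs in the window, and only once, window points and patterns are in
    bijection. *)
Lemma balanced_complexity S : S != fset0 -> connected_fset S ->
  lang S x #= `I_(#|` window S|) /\ lang S y #= `I_(#|` window S|).
Proof.
move=> S0 conn.
have [sepx sepy] := grown_separated hflip bal (connected_grown S0 conn).
have cnt z : separated z S -> (forall p, lang S z p ->
    exists2 u, u \in window S & agree S (shift u z) (extend p)) ->
    lang S z #= `I_(#|` window S|).
  move=> sep win.
  have -> : lang S z = [set` [fset pattern S (shift u z) | u in window S]%fset].
    apply/seteqP; split=> p /=.
      move=> /win[u uS up]; apply/imfsetP; exists u => //.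
      by apply/eqP; rewrite eq_sym -agree_extend.
    by case/imfsetP=> u _ ->; exists u; apply/occE; rewrite agree_extend.
  apply/card_eq_fsetP/card_in_imfset => u v uS vS /eqP e.
  apply: sep => //; rewrite -agree_extend in e.
  exact: agree_trans e (extend_pattern _ _).
by split; apply: cnt => // p Lp; case: (@language_window S p S0) => //; [left|right].
Qed.

End FromBalanced.

End Bridge.

(** * Complexity forces balance *)

Section Complexity.

Variables (d : nat) (x y : configuration d 'I_d.+1).
Hypothesis hflip : flip_condition x y.

Lemma card_window_add S v :
  #|` window (v |` S)%fset| = (#|` window S| + #|[pred j | fresh hflip S v j]|)%N.
Proof.
have := big_window_add hflip S v (fun=> 1%N).
by rewrite !card_fset_sum1 -sum1_card.
Qed.

(** A pattern of [x] recurs near a point [u] chosen so that all of [u + K] avoids the window; there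
    [x] and [y] agree. *)
Lemma recurrent_language (hd : (1 <= d)%N) S : uniformly_recurrent x ->
  (language S x `<=` language S y)%fset.
Proof.
move=> recx; apply/fsubsetP => p /languageP[n np].
have [|K Krec] := recx S p; first by exists n; apply/occE.
have [u uK] := fset_avoid hd [fset w - k | w in window S, k in K]%fset.
have [k kK /occE ukp] := Krec u.
apply/languageP; exists (u + k).
rewrite -(agree_eql _ (agree_off hflip (S := S) (u := u + k) _)) //.
apply: contra uK => ukS; apply/imfset2P; exists (u + k) => //; exists k => //.
by rewrite addrK.
Qed.

(* The patterns of [T = v |` S] satisfy no linear relation beyond those seen on
   [S] and on [v]: choosing one extension of each pattern of [S] and adding the
   differences of the patterns of [x] and [y] at the new points of the window
   gives as many independent vectors as there are patterns on [T]. *)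
Lemma balanced_step S s v :
  s \in S -> lattice_adj s v ->
  language S x = language S y ->
  language (v |` S)%fset x = language (v |` S)%fset y ->
  #|` language S x| = #|` window S| ->
  #|` language (v |` S)%fset x| = #|` window (v |` S)%fset| ->
  balanced x y [fset v]%fset -> balanced x y S -> balanced x y (v |` S)%fset.
Proof.
move=> sS sv eqS eqT cardS cardT balv balS; set T := (v |` S)%fset.
pose LS := language S x; pose LT := language T x.
have ex_ext (p : LS) : exists n, agree S (shift n x) (extend (val p)).
  exact/languageP/valP.
pose n_ p := xchoose (ex_ext p).
have n_P p : agree S (shift (n_ p) x) (extend (val p)) := xchooseP (ex_ext p).
pose D z (q : LT) : rat := (agree T z (extend (val q)))%:R.
(* One vector for each pattern of [S], one for each fresh letter, and the total defect of balance:
   one more than the dimension [#|LT|]. *)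
pose C (i : (LS + {j | j \in [pred j | fresh hflip S v j]} + unit)%type) (q : LT) : rat :=
  match i with
  | inl (inl p) => D (shift (n_ p) x) q
  | inl (inr j) => D (shift (site hflip (val j) - v) x) q
                   - D (shift (site hflip (val j) - v) y) q
  | inr _ => \sum_(u <- window T) (D (shift u x) q - D (shift u y) q)
  end.
have xLT n : pattern T (shift n x) \in LT by apply: pattern_language.
have yLT n : pattern T (shift n y) \in LT by rewrite /LT eqT pattern_language.
have [|lam [i0 lam0] lamC] := @linear_dependency rat _ _ C.
  by rewrite !card_sum card_unit -!cardfE cardT cardS card_window_add card_sig addn1 ltnS.
pose c j : rat := if insub j is Some j' then lam (inl (inr j')) else 0.
have rel (theta : configuration d 'I_d.+1 -> rat) : local_on T theta ->
    \sum_p lam (inl (inl p)) * theta (shift (n_ p) x)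
    + \sum_j c j * (theta (shift (site hflip j - v) x) - theta (shift (site hflip j - v) y))
    + lam (inr tt) * \sum_(u <- window T) (theta (shift u x) - theta (shift u y)) = 0.
  move=> loc.
  have pair z : pattern T z \in LT -> \sum_(q : LT) D z q * theta (extend (val q)) = theta z.
    exact: sum_extend.
  have : \sum_(q : LT) (\sum_i lam i * C i q) * theta (extend (val q)) = 0.
    by apply: big1 => q _; rewrite lamC mul0r.
  under eq_bigr do rewrite mulr_suml.
  rewrite exchange_big !big_sumType /= => e; rewrite -[RHS]e; congr (_ + _ + _).
  - apply: eq_bigr => p _; rewrite -[in LHS](pair (shift (n_ p) x)) // mulr_sumr.
    by apply: eq_bigr => q _; rewrite mulrA.
  - rewrite (bigID [pred j | fresh hflip S v j]) /= [X in _ + X]big1 ?addr0; last first.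
      by move=> j fj; rewrite /c insubN ?mul0r.
    rewrite (big_sub [pred j | fresh hflip S v j]); apply: eq_bigr => j _.
    rewrite /c valK -!pair // -sumrB mulr_sumr.
    by apply: eq_bigr => q _; rewrite -mulrBl mulrA.
  rewrite [RHS](bigD1 tt) //= [X in _ = _ + X]big1 ?addr0 => [|[]//].
  under [in RHS]eq_bigr do rewrite -mulrA mulr_suml.
  rewrite -mulr_sumr exchange_big; congr (_ * _).
  apply: eq_bigr => u _; rewrite -!pair // -sumrB.
  by apply: eq_bigr => q _; rewrite mulrBl.
have ratsum W (theta : configuration d 'I_d.+1 -> bool) :
    balanced x y W -> (W `<=` T)%fset -> local_on W theta ->
    \sum_(u <- window T) ((theta (shift u x))%:R - (theta (shift u y))%:R) = 0 :> rat.
  move=> balW WT loc.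
  have locz : local_on W (fun z => (theta z)%:R : int) by move=> z w /loc->.
  rewrite -(big_fset_incl _ (window_sub WT)) => [|u _ /(agree_off hflip)/loc->]; last first.
    by rewrite subrr.
  have /(congr1 (fun k : int => k%:~R : rat)) := balW _ locz.
  rewrite rmorph_sum /= => e; rewrite -[RHS]e; apply: eq_bigr => u _.
  by rewrite rmorphB /= !rmorph_nat.
(* Testing on the pattern [p] of [S] kills the fresh differences and, by [balS], the defect. *)
have lamS p : lam (inl (inl p)) = 0.
  pose test z := agree S z (extend (val p)).
  have loc : local_on S test by apply: local_agree.
  have ST : (S `<=` T)%fset by apply: fsubsetUr.
  have := rel (fun z => (test z)%:R).
  rewrite (ratsum S) // mulr0 addr0 [X in _ + X]big1 ?addr0; last first.
    move=> j _; rewrite /c; case: insubP => [j' fj _|]; last by rewrite mul0r.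
    by rewrite (loc _ _ (agree_off hflip fj)) subrr mulr0.
  rewrite (bigD1 p) //= /test n_P mulr1 big1 ?addr0 => [->//|q qp].
    by move=> z w /(agree_sub ST) /loc; rewrite /test => ->.
  have := n_P q; rewrite !agree_extend => /eqP->; case: eqP => [e|]; last by rewrite mulr0.
  by case/eqP: qp; apply: val_inj.
(* Testing on the letter at [v] kills the defect by [balv]; what remains is a cyclic relation,
   broken at a letter that is not fresh. *)
have cE j : c j = 0.
  have [j0 j0f] := fresh_missing hflip sS sv.
  suff -> : c j = c j0 by rewrite /c insubN.
  apply: cyclic_cut => a.
  pose test z := z v == a.
  have loc : local_on [fset v]%fset test.
    by move=> z w /agreeP/(_ v); rewrite /test => ->; rewrite ?fset11.
  have vT : ([fset v] `<=` T)%fset by rewrite fsub1set fset1U1.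
  have := rel (fun z => (test z)%:R).
  rewrite (ratsum [fset v]%fset) // mulr0 addr0 big1 ?add0r; last first.
    by move=> p _; rewrite lamS mul0r.
  under eq_bigr do rewrite /test /shift subrK x_site y_site.
  by apply=> z w /(agree_sub vT) /loc ->.
(* Only the defect is left in the relation, so its coefficient is nonzero and the defect itself
   vanishes. *)
have lam1 : lam (inr tt) != 0.
  case: i0 lam0 => [[p|j]|[]] //; first by rewrite lamS eqxx.
  by have := cE (val j); rewrite /c valK => ->; rewrite eqxx.
move=> Phi loc; have := rel (fun z => (Phi z)%:~R).
rewrite big1 ?add0r => [|p _]; last by rewrite lamS mul0r.
rewrite big1 ?add0r => [|j _]; last by rewrite cE mul0r.
move=> /(_ _)/eqP; rewrite mulf_eq0 (negPf lam1) /= => e.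
apply/eqP; rewrite -(intr_eq0 rat) rmorph_sum /=.
under eq_bigr do rewrite rmorphB.
by apply: e => z w /loc ->.
Qed.

(** Recurrence gives one inclusion of languages and equal cardinalities the other. Balance on one
    point holds because [x] and [y] show the same letters on the flip set; [balanced_step]
    propagates it. *)
Lemma complexity_balanced (hd : (1 <= d)%N) : uniformly_recurrent x ->
  (forall S : {fset lattice d}, S != fset0 -> connected_fset S ->
     lang S x #= `I_(#|` window S|) /\ lang S y #= `I_(#|` window S|)) ->
  forall S, balanced x y S.
Proof.
move=> recx cplx; apply: (balanced_cover hflip) => S gS.
have cardL W : grown W -> #|` language W x| = #|` window W| /\
    #|` language W y| = #|` window W|.
  move=> gW; have := cplx W (grown_nonempty gW) (grown_connected gW).
  by rewrite !lang_language => -[/card_eq_fsetP-> /card_eq_fsetP->].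
have eqL W : grown W -> language W x = language W y.
  move=> gW; apply/eqP; rewrite eqEfcard recurrent_language //.
  by have [-> ->] := cardL W gW; rewrite leqnn.
have bal1 w : balanced x y [fset w]%fset.
  move=> Phi loc.
  pose a : 'I_d.+1 -> int := fun j => Phi (fun=> j).
  have PhiE z : Phi z = a (z w).
    by apply: loc; apply/agreeP => t; rewrite inE => /eqP->.
  have -> : [fset w]%fset = (w |` fset0)%fset by rewrite fsetU0.
  rewrite (big_window_add hflip).
  have win0 : window (fset0 : {fset lattice d}) = fset0.
    by apply/fsetP => u; rewrite inE; apply/windowP => -[].
  rewrite /fresh win0 big_seq_fset0 add0r.
  under eq_bigr do rewrite !PhiE /shift subrK x_site y_site.
  rewrite (eq_bigl xpredT) => [|j]; last by rewrite inE.
  rewrite sumrB [X in X - _](reindex_inj (can_inj (@ord_predK d.+1))).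
  exact: subrr.
elim: gS => [s|W s v gW IH sW sv]; first exact: bal1.
have gT := grown_add gW sW sv.
apply: balanced_step sW sv (eqL W gW) (eqL _ gT) _ _ (bal1 v) IH.
  by case: (cardL W gW).
by case: (cardL _ gT).
Qed.

End Complexity.

(** * Rotations *)

Section Rotation.

Variables (R : realType) (d : nat) (x y : configuration d 'I_d.+1).
Variable alpha : 'rV[R]_d.
Hypothesis irr : totally_irrational alpha.
Hypothesis xE : forall n, (x n : nat)%:Z = c_floor alpha n.
Hypothesis yE : forall n, (y n : nat)%:Z = c_ceil alpha n.

Local Notation L n := (dotZ n alpha).

Lemma dotZ_irr v (q : int) : L v = q%:~R -> v = 0.
Proof.
move=> vq; have [|_ v0] := @irr (- q%:~R) (fun i => (v 0 i)%:~R).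
  rewrite mulr1 rmorphN /= ratr_int -vq /dotZ; apply/eqP.
  rewrite addrC subr_eq0; apply/eqP/eq_bigr => i _.
  by rewrite ratr_int.
apply/rowP => i; have /eqP := v0 i; rewrite intr_eq0 mxE => /eqP //.
Qed.

(* The representative in ]0, 1] of [L w - L u] modulo 1. *)
Definition gap u w : R := L w - L u - (Num.ceil (L w - L u) - 1)%:~R.

Lemma gap_itv u w : 0 < gap u w <= 1.
Proof.
by have := ceil_itv (L w - L u); rewrite /gap intrB; lra.
Qed.

Lemma gap_eq u w (k : int) e : 0 < e <= 1 -> L w - L u = k%:~R + e -> gap u w = e.
Proof.
move=> e01 E; rewrite /gap (@ceil_def _ _ (k + 1)); first by rewrite addrK E addrC addKr.
by rewrite addrK E intrD; lra.
Qed.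

Variable S : {fset lattice d}.

Lemma next_ex (u : window S) :
  exists w : window S, [forall w' : window S, gap (val u) (val w) <= gap (val u) (val w')].
Proof.
case: (Order.TotalTheory.arg_minP
  (fun w : window S => gap (val u) (val w)) (erefl (xpredT u))) => w _ wmin.
by exists w; apply/forallP => w'; apply: wmin.
Qed.

(** The window point following [u] in the cyclic order modulo 1; [u] itself, at gap 1, comes
    last. *)
Definition next (u : window S) : window S := xchoose (next_ex u).

Lemma next_min u w : w \in window S -> gap (val u) (val (next u)) <= gap (val u) w.
Proof. by move=> wS; have /forallP/(_ [` wS]%fset) := xchooseP (next_ex u). Qed.

(** If [u] and [u'] shared a successor with [u] closer to it, [u] would come after [u'] before that
    successor. Equal gaps make [L u - L u'] an integer, so [u = u']. *)
Lemma next_inj : injective next.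
Proof.
have lt_absurd u u' : next u = next u' ->
    gap (val u) (val (next u)) < gap (val u') (val (next u)) -> False.
  move=> e lt; have := next_min u' (valP u); rewrite -e leNgt => /negP; apply.
  have := gap_itv (val u) (val (next u)); have := gap_itv (val u') (val (next u)).
  set g' := gap (val u') _ in lt *; set g := gap (val u) _ in lt *.
  move=> g'01 g01; set w := val (next u).
  have gE : g = L w - L (val u) - (Num.ceil (L w - L (val u)) - 1)%:~R by [].
  have g'E : g' = L w - L (val u') - (Num.ceil (L w - L (val u')) - 1)%:~R by [].
  rewrite (@gap_eq _ _ (Num.ceil (L w - L (val u')) - Num.ceil (L w - L (val u))) (g' - g)).
  - by lra.
  - by lra.
  by move: gE g'E; rewrite !intrB; lra.
move=> u u' e; apply: val_inj.
have [lt|lt|eqg] := ltgtP (gap (val u) (val (next u))) (gap (val u') (val (next u))).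
- by case: (lt_absurd u u').
- by case: (lt_absurd u' u) => //; rewrite -e.
apply/eqP; rewrite -subr_eq0; apply/eqP.
pose k u := Num.ceil (L (val (next u)) - L (val u)).
apply: (@dotZ_irr _ (k u' - k u)); rewrite /k -e dotZD dotZN.
by move: eqg; rewrite /gap !intrB; lra.
Qed.

(** For [-t] in the window, the distance from [L (u + t)] up to the next integer is the gap from [u]
    to [-t], at least the gap to [next u]. So floors at [u + t] match ceilings at [next u + t] up to
    a constant, which cancels in each summand. *)
Lemma next_agree u : agree S (shift (val u) x) (shift (val (next u)) y).
Proof.
set w := val (next u).
pose m : int := Num.ceil (L w - L (val u)) - 1.
have ceilE t : - t \in window S ->
    Num.ceil (L (w + t)) = Num.floor (L (val u + t)) + m + 1.
  move=> tS; have := next_min u tS; rewrite -/w => min.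
  have g01 := gap_itv (val u) w.
  have gE : gap (val u) w = L w - L (val u) - m%:~R by [].
  have := floor_itv (L (val u + t)); set a := Num.floor _ => fl.
  have gtE : gap (val u) (- t) = a%:~R + 1 - L (val u + t).
    apply: (@gap_eq _ _ (- a - 1)); first by move: fl; rewrite intrD; lra.
    by rewrite dotZN dotZD intrB intrN; lra.
  clearbody m; apply: ceil_def; rewrite addrK !intrD.
  move: min gE g01 fl; rewrite gtE !dotZD intrD; lra.
apply/agreeP => s sS; apply: val_inj; apply/eqP; rewrite -eqz_nat; apply/eqP.
rewrite /shift [LHS]xE [RHS]yE; apply: eq_bigr => i _.
rewrite -!dotZ_basis -!dotZD ![basis_vec i + _]addrC -!addrA !ceilE.
- have shiftK (a b k : int) : a - b = a + k + 1 - (b + k + 1) by lia.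
  exact: shiftK.
- by apply/windowP; exists s; rewrite // opprD addrAC addNr add0r flip_setN.
by apply/windowP; exists s; rewrite // addNr flip_set0.
Qed.

Lemma rotation_balanced : balanced x y S.
Proof.
move=> Phi loc; rewrite sumrB; apply/eqP; rewrite subr_eq0; apply/eqP.
rewrite !big_seq_fsetE /= [RHS](reindex_inj next_inj) /=.
by apply: eq_bigr => u _; apply/loc/next_agree.
Qed.

End Rotation.

Theorem corollary3 (R : realType) (d : nat) (hd : (1 <= d)%N)
    (x y : configuration d 'I_d.+1) (hxy : asymptotic x y)
    (hx : uniformly_recurrent x) (hflip : flip_condition x y) :
  [<->
    (* (i) *)
    forall S : {fset lattice d}, S != fset0 -> connected_fset S ->
      forall p : {ffun S -> 'I_d.+1}, (lang S x `|` lang S y) p ->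
      (occ p x `\` occ p y) #= `I_1 /\ (occ p y `\` occ p x) #= `I_1;
    (* (ii) *)
    indistinguishable x y;
    (* (iii) *)
    forall S : {fset lattice d}, S != fset0 -> connected_fset S ->
      lang S x #= `I_(#|` minkowski_sub (flip_set d) S|) /\
      lang S y #= `I_(#|` minkowski_sub (flip_set d) S|);
    (* (iv) *)
    exists alpha : 'rV[R]_d,
      [/\ forall i, 0 <= alpha 0 i < 1,
          totally_irrational alpha,
          forall n, (x n : nat)%:Z = c_floor alpha n
        & forall n, (y n : nat)%:Z = c_ceil alpha n] ].
Proof.
have indP := indistinguishable_balanced hflip hxy.
(* The implications are proved in a cycle, the last one going from (iv) through balance back to
   (i). *)
tfae.
- by move=> uniq; apply/indP/unique_balanced.
- by move=> /indP bal S S0 conn; apply: (balanced_complexity hflip bal S0 conn).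
- move=> cplx; have bal := complexity_balanced hflip hd hx cplx.
  have [H H0 Hx] := height_exists hflip bal.
  have [alpha Halpha] := quasi_linear R (height_quasi hflip bal Hx H0).
  exists alpha; exact: (sturmian_of_height hflip hx bal H0 Hx Halpha).
case=> alpha [_ irr xE yE].
exact: (balanced_unique hflip (rotation_balanced irr xE yE)).
Qed.
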